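(* Let $q\in\mathbb{N}$ and let $w=(w_n)_{n\ge1}$ and $\mu=(\mu_n)_{n\ge1}$ be bounded sequences of scalars. If $$\lim_{n\to\infty}|w_1w_2\cdots w_{(n+r)^q-r^q+i}\,\mu_1\mu_2\cdots\mu_{(n+r)^q-r^q+j}|=\infty,\quad\text{uniformly in } r\ge0,$$ for all $i,j\in\mathbb{N}_0$, then $C_{B_w,F_\mu}$ is $q$-frequently hypercyclic on $(\mathcal{L}(\ell^1),\mathrm{SOT})$, and on $(\mathcal{K}(\ell^p),\|\cdot\|_{op})$ and $(\mathcal{L}(\ell^p),\mathrm{COT})$ for $1<p<\infty$.
   Context: $\mathbb{N}=\{1,2,\dots\}$, $\mathbb{N}_0=\mathbb{N}\cup\{0\}$; $r$ ranges over $\mathbb{N}_0$. With $\{e_n\}_{n\ge0}$ the standard basis of $\ell^p$, the weighted backward shift $B_w$ and forward shift $F_\mu$ are given by $B_w(e_0)=0$, $B_w(e_n)=w_ne_{n-1}$ ($n\ge1$) and $F_\mu(e_n)=\mu_{n+1}e_{n+1}$ ($n\ge0$). $C_{R,T}$ is the map $C_{R,T}(S)=RST$. $\mathcal{L}(X)$ and $\mathcal{K}(X)$ are the bounded and compact operators on $X$; SOT is the strong operator topology (pointwise convergence), COT the topology of uniform convergence on compact sets, $\|\cdot\|_{op}$ the operator norm. A continuous linear operator $A$ on a topological vector space $E$ is $q$-frequently hypercyclic if there is $x\in E$ such that for every non-empty open $V\subset E$ the set $M=\{n\in\mathbb{N}: A^nx\in V\}$ satisfies $\liminf_{N\to\infty}\frac{\mathrm{card}\{n\in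 M:\ n\le N^q\}}{N}>0$. *)

(* Defs.v *)
From HB Require Import structures.
From mathcomp Require Import all_boot all_order all_algebra.
From mathcomp Require Import complex.
From mathcomp Require Import all_classical all_reals all_analysis.

Set Implicit Arguments.
Unset Strict Implicit.
Unset Printing Implicit Defensive.

Import Order.TTheory GRing.Theory Num.Def Num.Theory.
Import numFieldNormedType.Exports.

Local Open Scope classical_set_scope.
Local Open Scope ring_scope.

(* The scalar field is left open: it is either R or R[i].  Norms of normed
   modules over R[i] are R[i]-valued, hence the translations [modulus] and
   [of_real] between the scalars and R. *)
Variant scalar_kind := RealScalars | ComplexScalars.

Definition scalars (R : realType) (k : scalar_kind) : numFieldType :=
  match k with
  | RealScalars => R
  | ComplexScalars => R[i]%C
  end.

Section Scalars.
Context {R : realType} {k : scalar_kind}.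

Definition modulus : scalars R k -> R :=
  match k return scalars R k -> R with
  | RealScalars => fun x => `|x|
  | ComplexScalars => fun z => complex.Re `|z|
  end.

Definition of_real : R -> scalars R k :=
  match k return R -> scalars R k with
  | RealScalars => fun x => x
  | ComplexScalars => fun x => x%:C%C
  end.

Lemma of_real_modulus (x : scalars R k) : of_real (modulus x) = `|x|.
Proof.
by rewrite /of_real /modulus; case: k x => //= x.
Qed.

Lemma of_realD : {morph of_real : x y / x + y}.
Proof. by rewrite /of_real; case: k => //= x y; rewrite rmorphD. Qed.

Lemma of_realM : {morph of_real : x y / x * y}.
Proof. by rewrite /of_real; case: k => //= x y; rewrite rmorphM. Qed.

Lemma of_real0 : of_real 0 = 0.
Proof. by rewrite /of_real; case: k. Qed.

Lemma of_real1 : of_real 1 = 1.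
Proof. by rewrite /of_real; case: k. Qed.

Lemma ler_of_real : {mono of_real : x y / x <= y}.
Proof. by rewrite /of_real; case: k => //= x y; rewrite lecR. Qed.

Lemma of_real_inj : injective of_real.
Proof. by move=> x y xy; apply/le_anti; rewrite -!ler_of_real xy lexx. Qed.

Lemma modulus_ge0 x : 0 <= modulus x.
Proof. by rewrite -ler_of_real of_real_modulus of_real0. Qed.

Lemma modulusD x y : modulus (x + y) <= modulus x + modulus y.
Proof. by rewrite -ler_of_real of_realD !of_real_modulus ler_normD. Qed.

Lemma modulusM x y : modulus (x * y) = modulus x * modulus y.
Proof. by apply: of_real_inj; rewrite of_realM !of_real_modulus normrM. Qed.

Lemma modulus0 : modulus 0 = 0.
Proof. by apply: of_real_inj; rewrite of_real_modulus of_real0 normr0. Qed.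

Lemma modulus1 : modulus 1 = 1.
Proof. by apply: of_real_inj; rewrite of_real_modulus of_real1 normr1. Qed.

Lemma modulus0_eq0 x : modulus x = 0 -> x = 0.
Proof.
by move=> x0; apply/normr0_eq0; rewrite -of_real_modulus x0 of_real0.
Qed.

Lemma modulus_of_real r : 0 <= r -> modulus (of_real r) = r.
Proof.
move=> r0; apply: of_real_inj; rewrite of_real_modulus ger0_norm//.
by rewrite -of_real0 ler_of_real.
Qed.

End Scalars.

Section BoundedOperators.
Context (K : numFieldType) (E : normedModType K).

(* On a normed module a linear map is bounded iff it is continuous
   ([linear_bounded_continuous]). *)
Definition lin_cont : {pred E -> E} :=
  fun f => `[< linear f /\ continuous f >].

Record bounded_op :=
  BoundedOp { bop_fun :> E -> E; bop_funP : bop_fun \in lin_cont }.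

HB.instance Definition _ := [isSub for bop_fun].
HB.instance Definition _ := [Choice of bounded_op by <:].

Lemma bop_linear (f : bounded_op) : linear f.
Proof. by case: f => f /= /asboolP[]. Qed.

Lemma bop_continuous (f : bounded_op) : continuous f.
Proof. by case: f => f /= /asboolP[]. Qed.

Lemma lin_cont_submod_closed : submod_closed lin_cont.
Proof.
split=> [|a f g /asboolP[lf cf] /asboolP[lg cg]]; apply/asboolP; split.
- by move=> a u v; change (0 = a *: (0 : E) + 0); rewrite scaler0 addr0.
- by move=> x; apply: cst_continuous.
- move=> b u v.
  change (a *: f (b *: u + v) + g (b *: u + v) =
    b *: (a *: f u + g u) + (a *: f v + g v)).
  rewrite lf lg !scalerDr !scalerA [a * b]mulrC.
  by rewrite addrACA.
- move=> x; apply: continuousD; last exact: cg.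
  by apply: continuousZl_tmp; exact: cf.
Qed.

HB.instance Definition _ :=
  GRing.isSubmodClosed.Build K (E -> E) lin_cont lin_cont_submod_closed.
HB.instance Definition _ := [SubChoice_isSubLmodule of bounded_op by <:].

HB.instance Definition _ (f : bounded_op) :=
  GRing.isLinear.Build K E E *:%R (bop_fun f) (bop_linear f).

Lemma bopD (f g : bounded_op) x : (f + g) x = f x + g x.
Proof. by []. Qed.
Lemma bopZ a (f : bounded_op) x : (a *: f) x = a *: f x.
Proof. by []. Qed.

End BoundedOperators.

Section InitialTopology.
Context (S : choiceType) (T : topologicalType) (f : S -> T).

Lemma initial_cvg (F : set_system S) (s : S) : Filter F ->
  f @ F --> f s -> F --> (s : initial_topology f).
Proof.
move=> FF Ff A; rewrite nbhs_simpl /= nbhsE => -[_ [[B Bop <-] Bs] BA].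
by apply: filterS BA _; apply: Ff; exact: open_nbhs_nbhs.
Qed.

End InitialTopology.

Section Topologies.
Context (K : numFieldType) (E : normedModType K).

(* Aliases of [bounded_op E] carrying the topology induced by, respectively,
   pointwise convergence and uniform convergence on compact sets. *)
Definition operators_SOT : Type := bounded_op E.

HB.instance Definition _ := GRing.Lmodule.on operators_SOT.
HB.instance Definition _ := Topological.copy operators_SOT
  (initial_topology (@bop_fun K E : bounded_op E -> {ptws E -> E})).

Definition operators_COT : Type := bounded_op E.

HB.instance Definition _ := GRing.Lmodule.on operators_COT.
HB.instance Definition _ := Topological.copy operators_COT
  (initial_topology (@bop_fun K E : bounded_op E -> {family compact, E -> E})).

Lemma SOT_cvgP (F : set_system operators_SOT) (s : operators_SOT) :
  Filter F -> F --> s <-> forall x, bop_fun f x @[f --> F] --> bop_fun s x.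
Proof.
move=> FF; split=> [Fs x|Fs].
  have /pointwise_cvgP : {ptws, @bop_fun K E @ F --> bop_fun s}.
    apply: (cvg_trans (cvg_app (@bop_fun K E) Fs)).
    exact: (@initial_continuous _ {ptws E -> E} (@bop_fun K E)).
  exact.
apply: (@initial_cvg _ {ptws E -> E}).
by apply/pointwise_cvgP => x; exact: Fs.
Qed.

Lemma COT_cvgP (F : set_system operators_COT) (s : operators_COT) :
  Filter F -> F --> s <->
  forall A : set E, compact A -> forall e, 0 < e ->
    F [set f : operators_COT | forall x, A x -> `|bop_fun s x - bop_fun f x| < e].
Proof.
move=> FF; split=> [Fs A cA e e0|Fs].
  have : {family compact, @bop_fun K E @ F --> bop_fun s}.
    apply: (cvg_trans (cvg_app (@bop_fun K E) Fs)).
    exact: (@initial_continuous _ {family compact, E -> E} (@bop_fun K E)).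
  move=> /(_ [set g : E -> E | forall y, A y -> ball (s y) e (g y)]).
  rewrite /= !nbhs_simpl /= => Fse.
  suff : F [set f : operators_COT |
      forall x, A x -> ball (bop_fun s x) e (bop_fun f x)].
    by rewrite -ball_normE.
  apply: Fse.
  by apply: (@fam_nbhs _ _ compact A [set xy | ball xy.1 e xy.2]) => //;
    exact: entourage_ball (PosNum e0).
apply: (@initial_cvg _ {family compact, E -> E}).
apply/fam_cvgP => A cA P /uniform_nbhs[B [entB BP]].
move: entB; rewrite -entourage_ballE => -[e e0 eB].
rewrite !nbhs_simpl /=.
apply: (@filterS _ F FF _ _ _ (Fs A cA e e0)) => f fA; apply: BP => x Ax.
by apply: eB; rewrite /= -ball_normE; exact: fA.
Qed.


Lemma SOT_add_continuous :
  continuous (fun x : operators_SOT * operators_SOT => x.1 + x.2).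
Proof.
move=> [f g]; apply/SOT_cvgP => x /=.
have fE : {for f, continuous (fun h : operators_SOT => bop_fun h x)}.
  by have /SOT_cvgP := @cvg_id _ (nbhs f); exact.
have gE : {for g, continuous (fun h : operators_SOT => bop_fun h x)}.
  by have /SOT_cvgP := @cvg_id _ (nbhs g); exact.
change ((fun z : operators_SOT * operators_SOT => bop_fun z.1 x + bop_fun z.2 x)
  @ nbhs (f, g) --> bop_fun f x + bop_fun g x).
apply: cvgD.
  by apply: (cvg_comp _ _ (@cvg_fst _ _ (nbhs f) (nbhs g) _) fE).
by apply: (cvg_comp _ _ (@cvg_snd _ _ (nbhs f) (nbhs g) _) gE).
Qed.

Lemma SOT_scale_continuous :
  continuous (fun z : K^o * operators_SOT => z.1 *: z.2).
Proof.
move=> [a g]; apply/SOT_cvgP => x /=.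
have gE : {for g, continuous (fun h : operators_SOT => bop_fun h x)}.
  by have /SOT_cvgP := @cvg_id _ (nbhs g); exact.
change ((fun z : K^o * operators_SOT => z.1 *: bop_fun z.2 x)
  @ nbhs (a, g) --> a *: bop_fun g x).
apply: cvgZ.
  exact: (@cvg_fst _ _ (nbhs a) (nbhs g) _).
by apply: (cvg_comp _ _ (@cvg_snd _ _ (nbhs a) (nbhs g) _) gE).
Qed.

HB.instance Definition _ :=
  PreTopologicalNmodule_isTopologicalNmodule.Build operators_SOT
    SOT_add_continuous.
HB.instance Definition _ :=
  TopologicalNmodule_isTopologicalLmodule.Build K operators_SOT
    SOT_scale_continuous.

Lemma COT_nbhs (f : operators_COT) (A : set E) (e : K) :
  compact A -> 0 < e ->
  \forall g \near f, forall x, A x -> `|bop_fun f x - bop_fun g x| < e.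
Proof.
by move=> cA e0; have /COT_cvgP := @cvg_id _ (nbhs f); apply.
Qed.

Lemma COT_add_continuous :
  continuous (fun x : operators_COT * operators_COT => x.1 + x.2).
Proof.
move=> [f g]; apply/COT_cvgP => A cA e e0 /=.
have e2 : 0 < e / 2 by rewrite divr_gt0.
have Hf := @cvg_fst _ _ (nbhs f) (nbhs g) _ _ (COT_nbhs f cA e2).
have Hg := @cvg_snd _ _ (nbhs f) (nbhs g) _ _ (COT_nbhs g cA e2).
near=> z => x Ax.
have zf : forall x, A x -> `|bop_fun f x - bop_fun z.1 x| < e / 2 by near: z; exact: Hf.
have zg : forall x, A x -> `|bop_fun g x - bop_fun z.2 x| < e / 2 by near: z; exact: Hg.
change (`|bop_fun f x + bop_fun g x - (bop_fun z.1 x + bop_fun z.2 x)| < e).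
rewrite opprD addrACA (le_lt_trans (ler_normD _ _))// (splitr e).
by rewrite ltrD ?zf ?zg.
Unshelve. all: by end_near. Qed.

Lemma COT_scale_continuous :
  continuous (fun z : K^o * operators_COT => z.1 *: z.2).
Proof.
move=> [a f]; apply/COT_cvgP => A cA e e0 /=.
have [M M0 fM] : exists2 M : K, 0 < M & forall x, A x -> `|bop_fun f x| <= M.
  have : \forall M \near +oo, A `<=` [set x | `|bop_fun f x| <= M].
    move: cA => /compact_near_coveringP; apply => x Ax.
    have fx1 : 0 <= `|bop_fun f x| + 1 by rewrite addr_ge0.
    exists ([set y | `|bop_fun f x - bop_fun f y| < 1],
        [set M | `|bop_fun f x| + 1 <= M]).
      split => /=.
        by move: (@bop_continuous _ _ f x) => /cvgrPdist_lt; apply.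
      by apply: nbhs_pinfty_ge; exact: ger0_real.
    move=> [y M] /= [fxy xM]; apply: le_trans xM.
    rewrite -(subKr (bop_fun f x) (bop_fun f y)).
    by rewrite (le_trans (ler_normB _ _))// lerD2l ltW.
  by move=> /pinfty_ex_gt0[M M0 fM]; exists M => // x Ax; exact: fM.
have a1 : 0 < `|a| + 1 by rewrite ltr_wpDl.
have e2 : 0 < e / 2 by rewrite divr_gt0.
have eM : 0 < e / 2 / M by rewrite divr_gt0.
have ea : 0 < e / 2 / (`|a| + 1) by rewrite divr_gt0.
have Ha1 := @cvg_fst _ _ (nbhs (a : K^o)) (nbhs f) _ _
  (nbhsx_ballx (a : K^o) 1 ltr01).
have HaM := @cvg_fst _ _ (nbhs (a : K^o)) (nbhs f) _ _
  (nbhsx_ballx (a : K^o) _ eM).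
have Hf := @cvg_snd _ _ (nbhs (a : K^o)) (nbhs f) _ _ (COT_nbhs f cA ea).
near=> z => x Ax.
have ab1 : `|a - z.1| < 1.
  by near: z; move: Ha1; rewrite -ball_normE; exact.
have abM : `|a - z.1| < e / 2 / M.
  by near: z; move: HaM; rewrite -ball_normE; exact.
have fg : forall x, A x ->
    `|bop_fun f x - bop_fun z.2 x| < e / 2 / (`|a| + 1).
  by near: z; exact: Hf.
change (`|a *: bop_fun f x - z.1 *: bop_fun z.2 x| < e).
have -> : a *: bop_fun f x - z.1 *: bop_fun z.2 x =
    (a - z.1) *: bop_fun f x + z.1 *: (bop_fun f x - bop_fun z.2 x).
  by rewrite scalerBl scalerBr addrA subrK.
rewrite (le_lt_trans (ler_normD _ _))// !normrZ (splitr e) ltrD//.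
  rewrite (le_lt_trans (ler_wpM2l _ (fM _ Ax)))// ?normr_ge0//.
  by rewrite -ltr_pdivlMr.
have ba : `|z.1| <= `|a| + 1.
  rewrite -[z.1](subKr a) (le_trans (ler_normB _ _))// lerD2l.
  exact: ltW.
rewrite (le_lt_trans (ler_wpM2r _ ba))// mulrC -ltr_pdivlMr//.
exact: fg.
Unshelve. all: by end_near. Qed.

HB.instance Definition _ :=
  PreTopologicalNmodule_isTopologicalNmodule.Build operators_COT
    COT_add_continuous.
HB.instance Definition _ :=
  TopologicalNmodule_isTopologicalLmodule.Build K operators_COT
    COT_scale_continuous.

End Topologies.

Section CompactOperators.
Context (K : numFieldType) (E : normedModType K).

(* [precompact] means that the closure is compact. *)
Definition compact_op_pred : {pred bounded_op E} :=
  fun f => `[< precompact (f @` [set x | `|x| <= 1]) >].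

Record compact_op :=
  CompactOp { cop_bop :> bounded_op E; cop_bopP : cop_bop \in compact_op_pred }.

HB.instance Definition _ := [isSub for cop_bop].
HB.instance Definition _ := [Choice of compact_op by <:].

Lemma compact_op_submod_closed : submod_closed compact_op_pred.
Proof.
split=> [|a f g /asboolP pf /asboolP pg]; apply/asboolP.
  apply: (@precompact_subset _ _ [set (0 : E)]).
    by move=> _ [x _ <-].
  rewrite precompact_closed; first exact: compact_set1.
  exact/accessible_closed_set1/hausdorff_accessible/norm_hausdorff.
have cfg : compact ((fun z : E * E => a *: z.1 + z.2) @`
    (closure (f @` [set x | `|x| <= 1]) `*` closure (g @` [set x | `|x| <= 1]))).
  apply: continuous_compact; last first.
    by apply: compact_setX; rewrite -precompactE.
  apply: continuous_subspaceT => z.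
  apply: cvgD; last exact: cvg_snd.
  by apply: cvgZ; [exact: cvg_cst | exact: cvg_fst].
apply: precompact_subset; last first.
  rewrite precompact_closed; first exact: cfg.
  by apply: compact_closed cfg; exact: norm_hausdorff.
move=> _ [x x1 <-]; exists (f x, g x) => //.
by split; apply: subset_closure; exists x.
Qed.

HB.instance Definition _ :=
  GRing.isSubmodClosed.Build K (bounded_op E) compact_op_pred
    compact_op_submod_closed.
HB.instance Definition _ := [SubChoice_isSubLmodule of compact_op by <:].

End CompactOperators.

Section Composition.
Context (K : numFieldType) (E : normedModType K).

Lemma comp_lin_cont (f g : bounded_op E) : f \o g \in @lin_cont K E.
Proof.
apply/asboolP; split=> [a u v|x] /=; first by rewrite !bop_linear.
by apply: continuous_comp; exact: bop_continuous.
Qed.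

Definition bop_comp (f g : bounded_op E) : bounded_op E :=
  BoundedOp (comp_lin_cont f g).

(* C_{A,T} : S |-> A S T *)
Definition sandwich (A T S : bounded_op E) : bounded_op E :=
  bop_comp A (bop_comp S T).

Lemma bop_bounded (f : bounded_op E) :
  exists2 M : K, 0 < M & forall x, `|f x| <= M * `|x|.
Proof.
have /linear_boundedP/pinfty_ex_gt0[M M0 fM] :
    bounded_near (bop_fun f) (nbhs (0 : E)).
  by apply: continuous_linear_bounded; exact: bop_continuous.
by exists M.
Qed.

Lemma sandwich_compact (A T : bounded_op E) (S : compact_op E) :
  sandwich A T S \in @compact_op_pred K E.
Proof.
apply/asboolP; have [M M0 TM] := bop_bounded T.
have cM : compact ((fun y => M *: A y) @` closure (S @` [set x | `|x| <= 1])).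
  apply: continuous_compact; last first.
    by rewrite -precompactE; exact/asboolP/cop_bopP.
  apply: continuous_subspaceT => z.
  by apply: cvgZ; [exact: cvg_cst | exact: bop_continuous].
apply: precompact_subset; last first.
  rewrite precompact_closed; first exact: cM.
  by apply: compact_closed cM; exact: norm_hausdorff.
move=> _ [x x1 <-] /=; exists (S (M^-1 *: T x)).
  apply: subset_closure; exists (M^-1 *: T x) => //=.
  rewrite normrZ gtr0_norm ?invr_gt0// ler_pdivrMl// mulr1.
  by rewrite (le_trans (TM x))// ler_piMr// ltW.
by rewrite !linearZ/= scalerA mulVf ?scale1r// gt_eqF.
Qed.

Definition sandwich_cop (A T : bounded_op E) (S : compact_op E) :
  compact_op E := CompactOp (sandwich_compact A T S).

End Composition.

Section OperatorNorm.
Context (R : realType) (k : scalar_kind).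
Local Notation K := (scalars R k).
Context (E : normedModType K).

Definition opnorm (f : bounded_op E) : R :=
  sup [set modulus `|f x| | x in [set x : E | `|x| <= 1]].

Lemma modulus_norm (a : K) : modulus `|a| = modulus a.
Proof. by apply: (@of_real_inj R k); rewrite !of_real_modulus normr_id. Qed.

Lemma modulus_norm_le (x y : E) : (modulus `|x| <= modulus `|y|) = (`|x| <= `|y|).
Proof. by rewrite -(@ler_of_real R k) !of_real_modulus !normr_id. Qed.

Lemma opnorm_le (f : bounded_op E) (M : R) :
  (forall x, `|x| <= 1 -> modulus `|f x| <= M) -> opnorm f <= M.
Proof.
move=> fM; apply: ge_sup.
  by exists (modulus `|f 0|), 0 => //=; rewrite normr0.
by move=> _ [x x1 <-]; exact: fM.
Qed.

Lemma opnorm_has_ubound (f : bounded_op E) :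
  has_ubound [set modulus `|f x| | x in [set x : E | `|x| <= 1]].
Proof.
have [M M0 fM] := bop_bounded f; exists (modulus M) => _ [x x1 <-].
rewrite -(@ler_of_real R k) !of_real_modulus normr_id gtr0_norm//.
by rewrite (le_trans (fM x))// ler_piMr// ltW.
Qed.

Lemma le_opnorm1 (f : bounded_op E) x :
  `|x| <= 1 -> modulus `|f x| <= opnorm f.
Proof. by move=> x1; apply: ub_le_sup; [exact: opnorm_has_ubound|exists x]. Qed.

Lemma opnorm_ge0 (f : bounded_op E) : 0 <= opnorm f.
Proof.
apply: (le_trans (modulus_ge0 `|f 0|)).
by apply: le_opnorm1; rewrite normr0.
Qed.

Lemma le_opnorm (f : bounded_op E) x :
  modulus `|f x| <= opnorm f * modulus `|x|.
Proof.
have [->|x0] := eqVneq x 0.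
  by rewrite linear0 normr0 modulus0 mulr0.
have nx : `|x| != 0 by rewrite normr_eq0.
have : modulus `|f (`|x|^-1 *: x)| <= opnorm f.
  by apply: le_opnorm1; rewrite normrZ normfV normr_id mulVf.
rewrite linearZ/= normrZ modulusM normfV normr_id => fx.
rewrite -[leLHS]mul1r -[X in X * _](@modulus1 R k) -(mulfV nx) modulusM.
by rewrite mulrAC -mulrA [leRHS]mulrC ler_wpM2l ?modulus_ge0// mulrC.
Qed.

Lemma opnormD (f g : bounded_op E) : opnorm (f + g) <= opnorm f + opnorm g.
Proof.
apply: opnorm_le => x x1; rewrite bopD.
rewrite (@le_trans _ _ (modulus (`|f x| + `|g x|)))//.
  rewrite -(@ler_of_real R k) !of_real_modulus normr_id ger0_norm ?addr_ge0//.
  exact: ler_normD.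
by rewrite (le_trans (modulusD _ _))// lerD// le_opnorm1.
Qed.

Lemma opnorm0 : opnorm 0 = 0.
Proof.
apply/le_anti; rewrite opnorm_ge0 andbT; apply: opnorm_le => x _.
by change (modulus `|0 : E| <= 0); rewrite normr0 modulus0.
Qed.

Lemma opnormZ a (f : bounded_op E) : opnorm (a *: f) = modulus a * opnorm f.
Proof.
have opZ b (g : bounded_op E) : opnorm (b *: g) <= modulus b * opnorm g.
  apply: opnorm_le => x x1; rewrite bopZ normrZ modulusM modulus_norm.
  by rewrite ler_wpM2l ?modulus_ge0// le_opnorm1.
apply/le_anti; rewrite opZ/=.
have [->|a0] := eqVneq a 0.
  by rewrite modulus0 mul0r opnorm_ge0.
have a1 : modulus a * modulus a^-1 = 1.
  by rewrite -modulusM mulfV// modulus1.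
rewrite -[f in leLHS]scale1r -(mulVf a0) -scalerA.
by rewrite (le_trans (ler_wpM2l (modulus_ge0 a) (opZ _ _)))// mulrA a1 mul1r.
Qed.

Lemma opnorm0_eq0 (f : bounded_op E) : opnorm f = 0 -> f = 0.
Proof.
move=> f0; apply: val_inj; apply/funext => x; apply: normr0_eq0.
apply: modulus0_eq0; apply/le_anti; rewrite modulus_ge0 andbT.
by rewrite (le_trans (le_opnorm f x))// f0 mul0r.
Qed.

(* the operator norm, as an element of the scalar field *)
Definition cop_norm (f : compact_op E) : K := of_real (opnorm f).

Lemma cop_normD f g : cop_norm (f + g) <= cop_norm f + cop_norm g.
Proof. by rewrite -of_realD ler_of_real; exact: opnormD. Qed.

Lemma cop_normZ a f : cop_norm (a *: f) = `|a| * cop_norm f.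
Proof. by rewrite -of_real_modulus -of_realM; congr of_real; exact: opnormZ. Qed.

Lemma cop_norm0_eq0 f : cop_norm f = 0 -> f = 0.
Proof.
by rewrite -(@of_real0 R k) => /of_real_inj/opnorm0_eq0 f0; exact: val_inj.
Qed.

HB.instance Definition _ := Lmodule_isNormed.Build K (compact_op E)
  cop_normD cop_normZ cop_norm0_eq0.

End OperatorNorm.

Section SequenceNorm.
Context (R : realType) (p : R).
Hypothesis p1 : 1 <= p.
Local Open Scope ereal_scope.

Let p0 : (0 < p)%R. Proof. exact: lt_le_trans p1. Qed.

Definition seq_enorm (u : nat -> R) : \bar R :=
  Lnorm counting p%:E (fun n => (u n)%:E).

Lemma seq_enormE u :
  seq_enorm u = (\sum_(n <oo) (`|u n| `^ p)%:E) `^ p^-1.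
Proof. by rewrite /seq_enorm Lnorm_counting. Qed.

Let sum_ge0 (u : nat -> R) : 0 <= \sum_(n <oo) (`|u n| `^ p)%:E.
Proof. by apply: nneseries_ge0 => n _ _; rewrite lee_fin powR_ge0. Qed.

Let le_root (x y : \bar R) : 0 <= x -> x <= y -> x `^ p^-1 <= y `^ p^-1.
Proof.
move=> x0 xy; apply: gt0_ler_poweR => //.
- by rewrite invr_ge0 ltW.
- by rewrite in_itv/= x0 leey.
- by rewrite in_itv/= (le_trans x0 xy) leey.
Qed.

Lemma le_seq_enorm u v : (forall n, `|u n| <= `|v n|)%R ->
  seq_enorm u <= seq_enorm v.
Proof.
move=> uv; rewrite !seq_enormE; apply: le_root => //.
apply: lee_nneseries => [n _ _|n _]; first by rewrite lee_fin powR_ge0.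
by rewrite lee_fin ge0_ler_powR ?nnegrE// ltW.
Qed.

Lemma seq_enormD u v : seq_enorm (u \+ v)%R <= seq_enorm u + seq_enorm v.
Proof. by apply: minkowski_EFin. Qed.

Lemma seq_enormZ a u : (0 <= a)%R ->
  seq_enorm (fun n => a * u n)%R = a%:E * seq_enorm u.
Proof.
move=> a0; rewrite !seq_enormE.
under eq_eseriesr do rewrite normrM powRM// EFinM.
rewrite nneseriesZl; last by move=> n _; rewrite lee_fin powR_ge0.
rewrite poweRM ?lee_fin ?powR_ge0// ger0_norm//; congr (_ * _).
by rewrite poweR_EFin -powRrM mulfV ?gt_eqF// powRr1.
Qed.

Lemma seq_enorm_term u m : `|u m|%:E <= seq_enorm u.
Proof.
rewrite seq_enormE (_ : `|u m|%:E = (`|u m| `^ p)%:E `^ p^-1); last first.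
  by rewrite poweR_EFin -powRrM mulfV ?gt_eqF// powRr1.
apply: le_root; first by rewrite lee_fin powR_ge0.
rewrite (@nneseriesD1 _ _ m xpredT)//.
by apply: leeDl; apply: nneseries_ge0 => n _ _; rewrite lee_fin powR_ge0.
Qed.

Lemma seq_enorm0 : seq_enorm (fun=> 0%R) = 0.
Proof.
by rewrite seq_enormE eseries0 ?poweR0r ?invr_neq0 ?gt_eqF// => n _ _;
  rewrite normr0 powR0// gt_eqF.
Qed.

Lemma seq_enorm_basis m : seq_enorm (fun n => (n == m)%:R) = 1.
Proof.
rewrite seq_enormE (@nneseriesD1 _ _ m xpredT)//.
rewrite eqxx normr1 powR1 eseries0 ?adde0 ?poweR1r// => n _ /= nm.
by rewrite (negbTE nm) normr0 powR0// gt_eqF.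
Qed.

Lemma seq_enorm_left u : seq_enorm (fun n => u n.+1) <= seq_enorm u.
Proof.
rewrite !seq_enormE; apply: le_root => //.
under eq_eseriesr do rewrite -addn1.
rewrite (nneseries_addn (f := fun n => (`|u n| `^ p)%:E)); last first.
  by move=> n; rewrite lee_fin powR_ge0.
rewrite [leRHS](@nneseries_recl _ xpredT)//.
by rewrite leeDr// lee_fin powR_ge0.
Qed.

Lemma seq_enorm_right u :
  seq_enorm (fun n => if n is n'.+1 then u n' else 0%R) = seq_enorm u.
Proof.
rewrite !seq_enormE [in LHS](@nneseries_recl _ xpredT)//.
rewrite normr0 powR0 ?gt_eqF// add0e -nneseries_addn; last first.
  by move=> n; rewrite lee_fin powR_ge0.
by under eq_eseriesr do rewrite addn1.
Qed.

End SequenceNorm.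

Section Lp.
Context (R : realType) (k : scalar_kind).
Local Notation K := (scalars R k).
Context (p : R) (p1 : 1 <= p).

Definition lp_enorm (x : nat -> K) : \bar R :=
  seq_enorm p (fun n => modulus (x n)).

(* The unused proof of 1 <= p makes the submodule structure of l^p inferable. *)
Definition lp_pred of 1 <= p : {pred nat -> K} :=
  fun x => (lp_enorm x < +oo)%E.

Record lp := Lp { lp_seq :> nat -> K; lp_seqP : lp_seq \in lp_pred p1 }.

HB.instance Definition _ := [isSub for lp_seq].
HB.instance Definition _ := [Choice of lp by <:].

Lemma lp_enormZ_le (a : R) (x y : nat -> K) : 0 <= a ->
  (forall n, modulus (x n) <= a * modulus (y n)) ->
  (lp_enorm x <= a%:E * lp_enorm y)%E.
Proof.
move=> a0 xy; rewrite -seq_enormZ//; apply: le_seq_enorm => // n.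
by rewrite !ger0_norm ?mulr_ge0 ?modulus_ge0.
Qed.

Lemma lp_enormD (x y : nat -> K) :
  (lp_enorm (fun n => x n + y n)%R <= lp_enorm x + lp_enorm y)%E.
Proof.
rewrite (le_trans _ (seq_enormD p1 _ _))//; apply: le_seq_enorm => // n /=.
by rewrite !ger0_norm ?addr_ge0 ?modulus_ge0 ?modulusD.
Qed.

Lemma lp_enormZ (a : K) (x : nat -> K) :
  lp_enorm (fun n => a * x n)%R = ((modulus a)%:E * lp_enorm x)%E.
Proof.
rewrite -seq_enormZ ?modulus_ge0//; congr seq_enorm; apply/funext => n.
exact: modulusM.
Qed.

Lemma lp_submod_closed : submod_closed (lp_pred p1).
Proof.
split.
  rewrite unfold_in /lp_enorm (_ : (fun _ => _) = fun=> 0).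
    by rewrite seq_enorm0// ltry.
  by apply/funext => n; exact: modulus0.
move=> a x y; rewrite !unfold_in => xoo yoo.
apply: le_lt_trans (lp_enormD (fun n => a * x n) y) _.
rewrite lte_add_pinfty// lp_enormZ lte_mul_pinfty ?lee_fin ?modulus_ge0//.
Qed.

HB.instance Definition _ :=
  GRing.isSubmodClosed.Build K (nat -> K) (lp_pred p1) lp_submod_closed.
HB.instance Definition _ := [SubChoice_isSubLmodule of lp by <:].

Definition lp_norm (x : lp) : K := of_real (fine (lp_enorm x)).

Lemma lp_enorm_fin (x : lp) : lp_enorm x \is a fin_num.
Proof. by rewrite ge0_fin_numE ?Lnorm_ge0//; exact: lp_seqP. Qed.

Lemma lp_normD x y : lp_norm (x + y) <= lp_norm x + lp_norm y.
Proof.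
rewrite -of_realD ler_of_real -fineD ?lp_enorm_fin//.
by rewrite fine_le ?fin_numD ?lp_enorm_fin//; exact: lp_enormD.
Qed.

Lemma lp_normZ a x : lp_norm (a *: x) = `|a| * lp_norm x.
Proof.
rewrite -of_real_modulus -of_realM; congr of_real.
have -> : lp_enorm (a *: x) = ((modulus a)%:E * lp_enorm x)%E by exact: lp_enormZ.
by rewrite fineM ?lp_enorm_fin.
Qed.

Lemma lp_norm0_eq0 x : lp_norm x = 0 -> x = 0.
Proof.
rewrite -(@of_real0 R k) => /of_real_inj x0.
apply: val_inj; apply/funext => n; apply: modulus0_eq0; apply/le_anti.
rewrite modulus_ge0 andbT -x0 -lee_fin fineK ?lp_enorm_fin//.
have := seq_enorm_term p1 (fun n => modulus (x n)) n.
by rewrite ger0_norm ?modulus_ge0.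
Qed.

HB.instance Definition _ := Lmodule_isNormed.Build K lp
  lp_normD lp_normZ lp_norm0_eq0.

End Lp.

Arguments lp {R} k {p} p1.

Section LinContBound.
Context (K : numFieldType) (E : normedModType K).

Lemma lin_cont_bound (f : E -> E) (M : K) : M \is Num.real -> linear f ->
  (forall x, `|f x| <= M * `|x|) -> f \in @lin_cont K E.
Proof.
move=> Mr lf fM; apply/asboolP; split => //.
pose g : {linear E -> E} := HB.pack f (GRing.isLinear.Build K E E *:%R f lf).
apply: (@bounded_linear_continuous _ _ _ g); apply/linear_boundedP.
near=> r => x; rewrite (le_trans (fM x))// ler_wpM2r//.
Unshelve. all: by end_near. Qed.

End LinContBound.

Section Shifts.
Context (R : realType) (k : scalar_kind).
Local Notation K := (scalars R k).

(* A sequence (w_n)_{n >= 1} is a function on nat whose value at 0 is never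
   used. *)
Definition bounded_weights (w : nat -> K) : Prop :=
  exists M : R, forall n, (0 < n)%N -> modulus (w n) <= M.

(* Coordinate forms of the weighted shifts; the values on the standard basis
   are [backward_shift_basis0], [backward_shift_basis], [forward_shift_basis]. *)
Definition bshift_seq (w x : nat -> K) : nat -> K :=
  fun n => w n.+1 * x n.+1.

Definition fshift_seq (mu x : nat -> K) : nat -> K :=
  fun n => if n is n'.+1 then mu n'.+1 * x n' else 0.

Context (p : R) (p1 : 1 <= p).
Local Notation lp := (lp k p1).

Lemma lp_basis_in n : (fun m => (m == n)%:R) \in @lp_pred R k p p1.
Proof.
rewrite unfold_in /lp_enorm.
rewrite (_ : (fun _ => _) = fun m => (m == n)%:R).
  by rewrite seq_enorm_basis ?ltry.
by apply/funext => m; case: (m == n); rewrite ?modulus1 ?modulus0.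
Qed.

Definition lp_basis n : lp := Lp (lp_basis_in n).

Section Weights.
Context (w : nat -> K) (wP : bounded_weights w).

Lemma bounded_weights_ge0 :
  exists2 M : R, 0 <= M & forall n, (0 < n)%N -> modulus (w n) <= M.
Proof.
by case: wP => M wM; exists M => //; rewrite (le_trans _ (wM 1%N _))// modulus_ge0.
Qed.

Lemma bshift_enorm : exists2 M : R, 0 <= M & forall x,
  (lp_enorm p (bshift_seq w x) <= M%:E * lp_enorm p x)%E.
Proof.
have [M M0 wM] := bounded_weights_ge0; exists M => // x.
apply: le_trans (lp_enormZ_le (y := fun n => x n.+1) p1 M0 _) _.
  by move=> n; rewrite modulusM ler_wpM2r ?modulus_ge0 ?wM.
by rewrite lee_wpmul2l ?lee_fin// seq_enorm_left.
Qed.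

Lemma fshift_enorm : exists2 M : R, 0 <= M & forall x,
  (lp_enorm p (fshift_seq w x) <= M%:E * lp_enorm p x)%E.
Proof.
have [M M0 wM] := bounded_weights_ge0; exists M => // x.
pose y n := if n is n'.+1 then x n' else 0.
apply: le_trans (lp_enormZ_le (y := y) p1 M0 _) _.
  case=> [|n]; first by rewrite modulus0 mulr0.
  by rewrite modulusM ler_wpM2r ?modulus_ge0 ?wM.
rewrite /lp_enorm -(seq_enorm_right p1 (fun n => modulus (x n))).
rewrite (_ : (fun n => modulus (y n)) =
  fun n => if n is n'.+1 then modulus (x n') else 0)//.
by apply/funext => -[|n] //=; rewrite modulus0.
Qed.

Lemma lp_in_of_enorm (f : (nat -> K) -> nat -> K) (M : R) (x : lp) :
  (lp_enorm p (f x) <= M%:E * lp_enorm p x)%E -> f x \in @lp_pred R k p p1.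
Proof.
rewrite unfold_in => /le_lt_trans; apply.
by rewrite ltey_eq fin_numM ?lp_enorm_fin.
Qed.

Lemma bshift_in (x : lp) : bshift_seq w x \in @lp_pred R k p p1.
Proof. by have [M M0 wM] := bshift_enorm; exact: lp_in_of_enorm (wM x). Qed.

Lemma fshift_in (x : lp) : fshift_seq w x \in @lp_pred R k p p1.
Proof. by have [M M0 wM] := fshift_enorm; exact: lp_in_of_enorm (wM x). Qed.

Lemma lp_norm_le (x y : lp) (M : R) :
  (lp_enorm p y <= M%:E * lp_enorm p x)%E -> `|y| <= of_real M * `|x|.
Proof.
move=> yx; change (lp_norm y <= of_real M * lp_norm x).
rewrite -of_realM ler_of_real -lee_fin EFinM.
by rewrite !fineK ?lp_enorm_fin.
Qed.

Lemma of_real_real (M : R) : 0 <= M -> of_real M \is @Num.real K.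
Proof. by move=> M0; apply: ger0_real; rewrite -of_real0 ler_of_real. Qed.

Lemma bshift_lin_cont : (fun x => Lp (bshift_in x)) \in @lin_cont K lp.
Proof.
have [M M0 wM] := bshift_enorm.
apply: (lin_cont_bound (of_real_real M0)) => [a x y|x].
  apply: val_inj; apply/funext => n.
  change (w n.+1 * (a * x n.+1 + y n.+1) =
    a * (w n.+1 * x n.+1) + w n.+1 * y n.+1).
  by rewrite mulrDr mulrCA.
exact: (@lp_norm_le x (Lp (bshift_in x)) M (wM x)).
Qed.

Lemma fshift_lin_cont : (fun x => Lp (fshift_in x)) \in @lin_cont K lp.
Proof.
have [M M0 wM] := fshift_enorm.
apply: (lin_cont_bound (of_real_real M0)) => [a x y|x].
  apply: val_inj; apply/funext => -[|n].
    by change (0 = a * 0 + 0 :> K); rewrite mulr0 addr0.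
  change (w n.+1 * (a * x n + y n) = a * (w n.+1 * x n) + w n.+1 * y n).
  by rewrite mulrDr mulrCA.
exact: (@lp_norm_le x (Lp (fshift_in x)) M (wM x)).
Qed.

Definition backward_shift : bounded_op lp := BoundedOp bshift_lin_cont.
Definition forward_shift : bounded_op lp := BoundedOp fshift_lin_cont.

Lemma backward_shift_basis0 : backward_shift (lp_basis 0) = 0.
Proof.
apply: val_inj; apply/funext => m.
by change (w m.+1 * (m.+1 == 0)%:R = 0 :> K); rewrite mulr0.
Qed.

Lemma backward_shift_basis n :
  (0 < n)%N -> backward_shift (lp_basis n) = w n *: lp_basis n.-1.
Proof.
case: n => // n _; apply: val_inj; apply/funext => m.
change (w m.+1 * (m.+1 == n.+1)%:R = w n.+1 * (m == n)%:R :> K).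
by rewrite eqSS; case: eqVneq => [->//|_]; rewrite !mulr0.
Qed.

Lemma forward_shift_basis n :
  forward_shift (lp_basis n) = w n.+1 *: lp_basis n.+1.
Proof.
apply: val_inj; apply/funext => -[|m].
  by change (0 = w n.+1 * 0 :> K); rewrite mulr0.
change (w m.+1 * (m == n)%:R = w n.+1 * (m.+1 == n.+1)%:R :> K).
by rewrite eqSS; case: eqVneq => [->//|_]; rewrite !mulr0.
Qed.

End Weights.
End Shifts.

Arguments backward_shift {R k p} p1 {w} wP.
Arguments forward_shift {R k p} p1 {w} wP.

Section FrequentHypercyclicity.
Context (R : realType) (K : numDomainType) (E : topologicalLmodType K).

Definition count_upto (M : set nat) (m : nat) : nat :=
  #|[pred n : 'I_m.+1 | `[< M n >]]|.

(* The liminf is taken in \bar R: for q > 1 the quotient need not be bounded. *)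
Definition q_frequently_hypercyclic (q : nat) (A : E -> E) : Prop :=
  [/\ linear A, continuous A &
    exists x : E, forall V : set E, open V -> V !=set0 ->
      (0 < limn_einf (fun N : nat =>
        ((count_upto [set n | (0 < n)%N /\ V (iter n A x)] (N ^ q))%:R
          / N%:R : R)%:E))%E].

End FrequentHypercyclicity.

Arguments q_frequently_hypercyclic R {K} E q A.

(* Main.v *)
Require Import Defs.
From HB Require Import structures.
From mathcomp Require Import all_boot all_order all_algebra.
From mathcomp Require Import complex.
From mathcomp Require Import all_classical all_reals all_analysis.
From mathcomp Require Import ring lra zify.

Import Order.TTheory GRing.Theory Num.Theory.
Import numFieldNormedType.Exports.

Local Open Scope classical_set_scope.
Local Open Scope ring_scope.

Set Implicit Arguments.
Unset Strict Implicit.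
Unset Printing Implicit Defensive.

(** Write [C] for the map [S |-> B_w S F_mu] and [W i j] for the product
    [w_1 ... w_i mu_1 ... mu_j]. The matrix of [C^n S] has the entries
    [W (i + n) (j + n) / W i j * S_(i+n, j+n)]: up to the weights, [C] is a
    backward shift along the diagonals. A finite matrix [y] thus has a preimage
    under [C^n], obtained by moving [y] down the diagonal by [n] and multiplying
    its entries by [W i j / W (i + n) (j + n)]. Operators built from disjoint
    diagonal blocks have the norm of their largest block, so that it is enough
    for these factors to be uniformly small. Bounds of this kind come from the
    Schur test ([schur_test], [blocks_schur]).

    Take finite matrices [y_l] such that every finite matrix is approximated by
    [y_l] with [l] arbitrarily large ([dense_finite_matrices]). Label natural
    numbers in such a way that each label is used with positive lower density,
    while points labelled [l] and [l'] are at distance at least [N l + N l']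
    ([separated_labels]). Let [D] be the block diagonal operator that has, at
    position [t^q] for every [t] labelled [l], the preimage of [y_l] under
    [C^(t^q)]. If [m] is labelled [l], then [C^(m^q)] pushes the blocks of
    [t < m] off the matrix, turns the block of [m] into [y_l], and leaves of the
    block of [t > m], labelled [l'], the preimage of [y_l'] under [C^s] with
    [s = t^q - m^q = ((t - m) + m)^q - m^q]. As [t - m] exceeds [N l] and [N l'],
    the limit hypothesis at [r = m], which is uniform in [r], bounds this
    remainder by [1 / (l + 1)] if the [N l] are large enough ([block_widths],
    [orbit_close]). The blocks tend to zero, hence [D] is compact. The points
    carrying one label have positive lower density, and their [q]-th powers are
    the return times.

    The orbit of [D] therefore visits each operator-norm ball around a finite
    matrix often enough ([dense_orbit]), and for each of the three topologies it
    remains to find such a ball in every nonempty open set. The finite sections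
    [P_n T P_n] converge to [T] uniformly on compact sets, a fortiori pointwise;
    if [T] is compact and [p > 1] they converge in operator norm, because the
    functionals on [l^p] then have small tails ([functional_tail],
    [finite_section_cvg]). *)

(** * The Schur test *)

Section Schur.
Context (R : realType) (p : R).
Hypothesis p1 : 1 <= p.

Let p0 : 0 < p. Proof. exact: lt_le_trans p1. Qed.

(** Young's inequality for [u * 1], multiplied by [p]: the graph of the power
    function lies above its tangent at 1. *)
Lemma bernoulli_powR (u : R) : 0 <= u -> p * u <= u `^ p + (p - 1).
Proof.
move=> u0; have [->|pn1] := eqVneq p 1.
  by rewrite powRr1// mul1r subrr addr0.
have pgt1 : 1 < p by rewrite lt_neqAle eq_sym pn1.
have pp : p - 1 != 0 by rewrite subr_eq0.
have pn0 : p != 0 by rewrite gt_eqF.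
have := @conjugate_powR _ u 1 p (p / (p - 1)) u0 ler01 p0.
rewrite divr_gt0 ?subr_gt0// => /(_ isT).
have -> : p^-1 + (p / (p - 1))^-1 = 1 by field; rewrite pp.
move=> /(_ erefl); rewrite powR1 mulr1.
move=> /(ler_wpM2l (ltW p0)) /le_trans; apply.
by rewrite mulrDr mulrCA divff// mulr1 lerD2l mul1r invf_div mulrCA divff// mulr1.
Qed.

(** Jensen's inequality. A total mass below 1 is harmless because the tangent
    of the power function at [m] is at most 0 at the origin. *)
Lemma sub_jensen (I : Type) (s : seq I) (a t : I -> R) :
  (forall i, 0 <= a i) -> (forall i, 0 <= t i) ->
  \sum_(i <- s) a i <= 1 ->
  (\sum_(i <- s) a i * t i) `^ p <= \sum_(i <- s) a i * t i `^ p.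
Proof.
move=> a0 t0 a1; set m := \sum_(i <- s) a i * t i.
have m0 : 0 <= m by apply: sumr_ge0 => i _; rewrite mulr_ge0.
have [mE|mn0] := eqVneq m 0.
  by rewrite mE powR0 ?gt_eqF//; apply: sumr_ge0 => i _; rewrite mulr_ge0 ?powR_ge0.
have mgt0 : 0 < m by rewrite lt_neqAle eq_sym mn0.
have mp0 : 0 < m `^ p by rewrite powR_gt0.
(* the tangent at m, obtained from the one at 1 by homogeneity *)
have tangent i : m `^ p * (p * (t i / m) - (p - 1)) <= t i `^ p.
  have := bernoulli_powR (divr_ge0 (t0 i) m0).
  rewrite -lerBlDr => /(ler_wpM2l (ltW mp0)) /le_trans; apply.
  by rewrite -powRM ?divr_ge0// mulrC divfK.
apply: le_trans (ler_sum _ (fun i _ => ler_wpM2l (a0 i) (tangent i))).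
have -> : \sum_(i <- s) a i * (m `^ p * (p * (t i / m) - (p - 1))) =
    m `^ p * (p - (p - 1) * \sum_(i <- s) a i).
  rewrite -[X in _ = _ * (X - _)]mulr1 -(divff mn0) [in RHS]/m mulr_suml.
  rewrite !mulr_sumr -sumrB mulr_sumr; apply: eq_bigr => i _.
  by rewrite -/m; ring.
rewrite ler_peMr ?powR_ge0// -subr_ge0.
rewrite (_ : _ - 1 = (p - 1) * (1 - \sum_(i <- s) a i)); last ring.
by rewrite mulr_ge0// subr_ge0.
Qed.

(** Jensen's inequality in each row makes the left-hand side linear in
    [t j `^ p]; after an exchange of sums the column sums are the coefficients. *)
Lemma schur_test (a : nat -> nat -> R) (h : nat -> nat) (t : nat -> R) (n : nat) :
  (forall i j, 0 <= a i j) -> (forall j, 0 <= t j) ->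
  (forall i, \sum_(j < h i) a i j <= 1) ->
  (forall j m, \sum_(i < m) a i j <= 1) ->
  exists m : nat,
  \sum_(i < n) (\sum_(j < h i) a i j * t j) `^ p <= \sum_(j < m) t j `^ p.
Proof.
move=> a0 t0 row col; exists (\max_(i < n) h i).
apply: (@le_trans _ _ (\sum_(i < n) \sum_(j < \max_(i < n) h i)
    a i j * t j `^ p)); last first.
  rewrite exchange_big/=; apply: ler_sum => j _.
  by rewrite -mulr_suml ler_piMl ?powR_ge0 ?col.
apply: ler_sum => i _; apply: le_trans (sub_jensen _ _ (row i)) _ => //.
have hi : (h i <= \max_(i < n) h i)%N by exact: (@leq_bigmax _ (fun i : 'I_n => h i)).
rewrite (big_ord_widen _ (fun j => a i j * t j `^ p) hi).
rewrite [leRHS](bigID (fun j : 'I__ => (j < h i)%N))/= [leRHS]addrC ler_wpDl//.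
  by apply: sumr_ge0 => j _; rewrite mulr_ge0 ?powR_ge0.
Qed.

End Schur.

(** * Norms with values in the reals *)

Section ScalarTools.
Context {R : realType} {k : scalar_kind}.
Local Notation K := (scalars R k).

Lemma modulusN (x : K) : modulus (- x) = modulus x.
Proof. by apply: (@of_real_inj R k); rewrite !of_real_modulus normrN. Qed.

Lemma modulusV (x : K) : modulus x^-1 = (modulus x)^-1.
Proof.
have [->|x0] := eqVneq x 0; first by rewrite invr0 modulus0 invr0.
have mx0 : modulus x != 0 by apply: contra_neq x0; exact: modulus0_eq0.
by apply: (mulfI mx0); rewrite -modulusM !divff// modulus1.
Qed.

Lemma modulus_eq0 (x : K) : (modulus x == 0) = (x == 0).
Proof.
by apply/eqP/eqP => [/modulus0_eq0//|->]; exact: modulus0.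
Qed.

Lemma modulus_gt0 (x : K) : (0 < modulus x) = (x != 0).
Proof. by rewrite lt_neqAle modulus_ge0 andbT eq_sym modulus_eq0. Qed.

Lemma ltr_of_real : {mono (@of_real R k) : x y / x < y}.
Proof. by move=> x y; rewrite !lt_neqAle ler_of_real (inj_eq of_real_inj). Qed.

Lemma modulus_sum (I : Type) (s : seq I) (P : pred I) (f : I -> K) :
  modulus (\sum_(i <- s | P i) f i) <= \sum_(i <- s | P i) modulus (f i).
Proof.
elim/big_ind2 : _ => [|x1 x2 y1 y2 h1 h2|//]; first by rewrite modulus0.
by rewrite (le_trans (modulusD _ _))// lerD.
Qed.

End ScalarTools.

(** Norms of modules over [R[i]] are complex-valued; [nrm] is the same number
    as an element of [R], where suprema and powers live. *)
Definition nrm {R : realType} {k : scalar_kind}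
  {E : normedModType (scalars R k)} (x : E) : R := modulus `|x|.

Section RealNorm.
Context {R : realType} {k : scalar_kind} {E : normedModType (scalars R k)}.
Implicit Types x y : E.

Lemma of_real_nrm x : of_real (nrm x) = `|x|.
Proof. by rewrite of_real_modulus normr_id. Qed.

Lemma nrm_ge0 x : 0 <= nrm x. Proof. exact: modulus_ge0. Qed.

Lemma nrmD x y : nrm (x + y) <= nrm x + nrm y.
Proof. by rewrite -(@ler_of_real R k) of_realD !of_real_nrm ler_normD. Qed.

Lemma nrmN x : nrm (- x) = nrm x. Proof. by rewrite /nrm normrN. Qed.

Lemma nrmB x y : nrm (x - y) = nrm (y - x).
Proof. by rewrite -nrmN opprB. Qed.

Lemma nrmZ a x : nrm (a *: x) = modulus a * nrm x.
Proof. by rewrite /nrm normrZ modulusM modulus_norm. Qed.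

Lemma nrm0 : nrm (0 : E) = 0. Proof. by rewrite /nrm normr0 modulus0. Qed.

Lemma norm_lt_nrm (x : E) (e : R) : (`|x| < of_real e) = (nrm x < e).
Proof. by rewrite -of_real_nrm ltr_of_real. Qed.

Lemma norm_le_nrm (x : E) (e : R) : (`|x| <= of_real e) = (nrm x <= e).
Proof. by rewrite -of_real_nrm ler_of_real. Qed.

Lemma nrm_le1 (x : E) : (`|x| <= 1) = (nrm x <= 1).
Proof. by rewrite -norm_le_nrm of_real1. Qed.

Lemma gt0_of_real (e : scalars R k) : 0 < e -> exists2 r : R, 0 < r & e = of_real r.
Proof.
move=> e0; exists (modulus e); first by rewrite modulus_gt0 gt_eqF.
by rewrite of_real_modulus gtr0_norm.
Qed.

End RealNorm.

Section LpNorm.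
Context {R : realType} {k : scalar_kind} {p : R} (p1 : 1 <= p).
Local Notation K := (scalars R k).
Local Notation lp := (lp k p1).

Let p0 : 0 < p. Proof. exact: lt_le_trans p1. Qed.
Let pn0 : p != 0. Proof. by rewrite gt_eqF. Qed.

Definition psum (x : nat -> K) (n : nat) : R := \sum_(i < n) modulus (x i) `^ p.

Lemma le_psum x y n : (forall i, modulus (x i) <= modulus (y i)) ->
  psum x n <= psum y n.
Proof.
move=> xy; apply: ler_sum => i _.
by rewrite ge0_ler_powR ?nnegrE ?modulus_ge0// ltW.
Qed.

Lemma lp_enorm_le (x : nat -> K) (c : R) : 0 <= c ->
  (forall n, psum x n <= c `^ p) -> (lp_enorm p x <= c%:E)%E.
Proof.
move=> c0 xc; rewrite /lp_enorm seq_enormE//.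
rewrite (_ : c%:E = (poweR (c `^ p)%:E p^-1))%E; last first.
  by rewrite poweR_EFin -powRrM mulfV// powRr1.
have s0 (u : nat -> R) : (0 <= \sum_(n <oo) (`|u n| `^ p)%:E)%E.
  by apply: nneseries_ge0 => n _ _; rewrite lee_fin powR_ge0.
apply: gt0_ler_poweR; first by rewrite invr_ge0 ltW.
- by rewrite in_itv/= s0 leey.
- by rewrite in_itv/= lee_fin powR_ge0 leey.
apply: lime_le.
  by apply: is_cvg_nneseries => n _ _; rewrite lee_fin powR_ge0.
apply: nearW => n; rewrite big_mkord sumEFin lee_fin.
apply: le_trans (xc n); rewrite le_eqVlt; apply/orP; left; apply/eqP.
by apply: eq_bigr => i _; rewrite ger0_norm ?modulus_ge0.
Qed.

Lemma lp_mem (x : nat -> K) (c : R) : 0 <= c ->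
  (forall n, psum x n <= c `^ p) -> x \in @lp_pred R k p p1.
Proof.
by move=> c0 xc; rewrite unfold_in (le_lt_trans (lp_enorm_le c0 xc))// ltry.
Qed.

Lemma nrm_lpE (x : lp) : nrm x = fine (lp_enorm p x).
Proof.
apply: (@of_real_inj R k); rewrite of_real_nrm.
by change (lp_norm x = of_real (fine (lp_enorm p x))).
Qed.

(** With the converse [psum_le_nrm], this reduces norm estimates in [l^p] to
    finite sums. *)
Lemma nrm_lp_le (x : lp) (c : R) : 0 <= c ->
  (forall n, psum x n <= c `^ p) -> nrm x <= c.
Proof.
by move=> c0 xc; rewrite nrm_lpE -lee_fin fineK ?lp_enorm_fin ?lp_enorm_le.
Qed.

Lemma psum_le_nrm (x : lp) n : psum x n <= nrm x `^ p.
Proof.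
rewrite -lee_fin nrm_lpE -poweR_EFin fineK ?lp_enorm_fin// /lp_enorm seq_enormE//.
rewrite -poweRrM mulVf// poweRe1; last first.
  by apply: nneseries_ge0 => i _ _; rewrite lee_fin powR_ge0.
apply: le_trans (nneseries_lim_ge n _); last by move=> *; rewrite lee_fin powR_ge0.
rewrite big_mkord sumEFin lee_fin le_eqVlt; apply/orP; left; apply/eqP.
by apply: eq_bigr => i _; rewrite ger0_norm ?modulus_ge0.
Qed.

Lemma modulus_le_nrm (x : lp) i : modulus (x i) <= nrm x.
Proof.
have : modulus (x i) `^ p <= nrm x `^ p.
  apply: le_trans (psum_le_nrm x i.+1).
  by rewrite /psum big_ord_recr/= lerDr; apply: sumr_ge0 => j _; rewrite powR_ge0.
apply: contraTT; rewrite -!ltNge => h.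
by rewrite gt0_ltr_powR ?nnegrE ?modulus_ge0.
Qed.

Lemma nrm_lp_mono (x y : lp) :
  (forall i, modulus (x i) <= modulus (y i)) -> nrm x <= nrm y.
Proof.
move=> xy; apply: nrm_lp_le => [|n]; first exact: nrm_ge0.
exact: le_trans (le_psum _ xy) (psum_le_nrm _ _).
Qed.

End LpNorm.
Arguments psum {R k} p x n.

(** * Operators on l^p given by matrices *)

Section LpOperators.
Context {R : realType} {k : scalar_kind} {p : R} (p1 : 1 <= p).
Local Notation K := (scalars R k).
Local Notation lp := (lp k p1).

Let p0 : 0 < p. Proof. exact: lt_le_trans p1. Qed.

Lemma lp_ext (x y : lp) : (forall i, x i = y i) -> x = y.
Proof. by move=> xy; apply: val_inj; apply/funext. Qed.

Lemma bop_ext (E : normedModType K) (f g : bounded_op E) :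
  (forall x, f x = g x) -> f = g.
Proof. by move=> fg; apply: val_inj; apply/funext. Qed.

Lemma lpD (x y : lp) i : (x + y) i = x i + y i. Proof. by []. Qed.
Lemma lpB (x y : lp) i : (x - y) i = x i - y i. Proof. by []. Qed.
Lemma lpZ a (x : lp) i : (a *: x) i = a * x i. Proof. by []. Qed.
Lemma lp0 i : (0 : lp) i = 0. Proof. by []. Qed.

Lemma opnorm_le_nrm (E : normedModType K) (f : bounded_op E) (c : R) :
  0 <= c -> (forall x, nrm (f x) <= c * nrm x) -> opnorm f <= c.
Proof.
move=> c0 fc; apply: opnorm_le => x; rewrite nrm_le1 => x1.
by rewrite (le_trans (fc x))// ler_piMr.
Qed.

Lemma seq_op (f : (nat -> K) -> nat -> K) (c : R) : 0 <= c ->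
  (forall a x y i, f (fun j => a * x j + y j) i = a * f x i + f y i) ->
  (forall (x : lp) n, psum p (f x) n <= (c * nrm x) `^ p) ->
  exists2 g : bounded_op lp, (forall x i, g x i = f x i) & opnorm g <= c.
Proof.
move=> c0 flin fc.
have cx0 (x : lp) : 0 <= c * nrm x by rewrite mulr_ge0 ?nrm_ge0.
have fin (x : lp) : f x \in @lp_pred R k p p1 := lp_mem p1 (cx0 x) (fc x).
pose g (x : lp) : lp := Lp (fin x).
have gc x : nrm (g x) <= c * nrm x by apply: nrm_lp_le => // n; exact: fc.
have gin : g \in @lin_cont K lp.
  apply: (lin_cont_bound (of_real_real k c0)) => [a x y|x].
    apply: lp_ext => i.
    by change (f (fun j => a * x j + y j) i = a * f x i + f y i); exact: flin.
  by rewrite -!of_real_nrm -of_realM ler_of_real.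
by exists (BoundedOp gin) => //; exact: opnorm_le_nrm.
Qed.

(** Row [i] of the matrix is cut at [h i], so that all sums are finite. *)
Definition mx_act (h : nat -> nat) (M : nat -> nat -> K) (x : nat -> K) i : K :=
  \sum_(j < h i) M i j * x j.

Definition schur_bounded (h : nat -> nat) (M : nat -> nat -> K) (c : R) :=
  (forall i, \sum_(j < h i) modulus (M i j) <= c) /\
  (forall j n, \sum_(i < n) modulus (M i j) <= c).

Lemma psum_mx_act h M c (x : lp) n : 0 < c -> schur_bounded h M c ->
  psum p (mx_act h M x) n <= (c * nrm x) `^ p.
Proof.
move=> c0 [row col].
have cV0 : 0 <= c^-1 by rewrite invr_ge0 ltW.
have [m am] := @schur_test _ p p1 (fun i j => modulus (M i j) / c) h
  (fun j => modulus (x j)) n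
  (fun i j => mulr_ge0 (modulus_ge0 _) cV0) (fun j => modulus_ge0 _)
  (fun i => ltac:(by rewrite -mulr_suml ler_pdivrMr// mul1r))
  (fun j m => ltac:(by rewrite -mulr_suml ler_pdivrMr// mul1r)).
rewrite powRM ?nrm_ge0 ?(ltW c0)//.
have {}am := ler_wpM2l (powR_ge0 c p) (le_trans am (psum_le_nrm x m)).
apply: le_trans am.
rewrite /psum mulr_sumr; apply: ler_sum => i _.
rewrite -powRM ?(ltW c0)//; last first.
  by apply: sumr_ge0 => j _; rewrite mulr_ge0 ?modulus_ge0// mulr_ge0 ?modulus_ge0.
rewrite ge0_ler_powR ?(ltW p0) ?nnegrE ?modulus_ge0//.
  rewrite mulr_ge0 ?(ltW c0)//; apply: sumr_ge0 => j _.
  by rewrite mulr_ge0 ?modulus_ge0// mulr_ge0 ?modulus_ge0.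
rewrite (le_trans (modulus_sum _ _ _))// mulr_sumr; apply: ler_sum => j _.
by rewrite modulusM mulrA (mulrC c) mulfVK ?gt_eqF.
Qed.

Lemma mx_op h M c : 0 < c -> schur_bounded h M c ->
  exists2 g : bounded_op lp, (forall x i, g x i = mx_act h M x i) & opnorm g <= c.
Proof.
move=> c0 Mc; apply: seq_op (ltW c0) _ _ => [a x y i|x n].
  rewrite /mx_act mulr_sumr -big_split/=; apply: eq_bigr => j _.
  by rewrite mulrDr mulrCA.
exact: psum_mx_act.
Qed.

Lemma opnorm_mx (g : bounded_op lp) h M c : 0 < c -> schur_bounded h M c ->
  (forall x i, g x i = mx_act h M x i) -> opnorm g <= c.
Proof.
move=> c0 Mc gM; have [f fM fc] := mx_op c0 Mc.
by rewrite (_ : g = f)//; apply: bop_ext => x; apply: lp_ext => i; rewrite gM fM.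
Qed.

Lemma lp_proj_subproof n : exists2 g : bounded_op lp,
  (forall x i, g x i = if (i < n)%N then x i else 0) & opnorm g <= 1.
Proof.
apply: (@seq_op (fun x i => if (i < n)%N then x i else 0)) => //.
  by move=> a x y i; case: ifP => // _; rewrite mulr0 addr0.
move=> x m; rewrite mul1r (le_trans _ (psum_le_nrm x m))//.
by apply: le_psum => // i; case: ifP => // _; rewrite modulus0 modulus_ge0.
Qed.

Definition lp_proj n : bounded_op lp := s2val (cid2 (lp_proj_subproof n)).

Lemma lp_projE n x i : lp_proj n x i = if (i < n)%N then x i else 0.
Proof. exact: (s2valP (cid2 (lp_proj_subproof n))). Qed.

Lemma nrm_lp_proj n (x : lp) : nrm (lp_proj n x) <= nrm x.
Proof.
apply: nrm_lp_mono => i; rewrite lp_projE.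
by case: ifP => // _; rewrite modulus0 modulus_ge0.
Qed.

Lemma nrm_tail n (x : lp) : nrm (x - lp_proj n x) <= nrm x.
Proof.
apply: nrm_lp_mono => i; rewrite lpB lp_projE.
by case: ifP => // _; rewrite ?subrr ?modulus0 ?modulus_ge0// subr0.
Qed.

Lemma nrm_tail_mono m n (x : lp) : (m <= n)%N ->
  nrm (x - lp_proj n x) <= nrm (x - lp_proj m x).
Proof.
move=> mn; apply: nrm_lp_mono => i; rewrite !lpB !lp_projE.
case: (ltnP i n) => ni; first by rewrite subrr modulus0 modulus_ge0.
by rewrite ltnNge (leq_trans mn ni)/=.
Qed.

(** The [p]-th power of the norm of the tail is what the partial sum misses of
    the [p]-th power of the norm. *)
Lemma lp_proj_cvg (x : lp) (e : R) : 0 < e ->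
  exists n0, forall n, (n0 <= n)%N -> nrm (x - lp_proj n x) <= e.
Proof.
move=> e0; suff [n0 n0e] : exists n0, nrm (x - lp_proj n0 x) <= e.
  by exists n0 => n n0n; rewrite (le_trans (nrm_tail_mono _ n0n)).
have [xe|ex] := leP (nrm x) e.
  by exists 0%N; rewrite (le_trans (nrm_tail _ _)).
have ep0 : 0 < e `^ p by rewrite powR_gt0.
have exp : e `^ p < nrm x `^ p by rewrite gt0_ltr_powR ?nnegrE ?nrm_ge0 ?(ltW e0).
pose c := (nrm x `^ p - e `^ p) `^ p^-1.
have cp : c `^ p = nrm x `^ p - e `^ p.
  by rewrite -powRrM mulVf ?gt_eqF// powRr1// subr_ge0 ltW.
have [n0 cn0] : exists n0, c `^ p < psum p x n0.
  apply/not_existsP => /= h; have : nrm x <= c.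
    by apply: nrm_lp_le => [|n]; [exact: powR_ge0|rewrite leNgt; apply/negP/h].
  apply/negP; rewrite -ltNge.
  have : c `^ p < nrm x `^ p by rewrite cp gtrBl.
  apply: contraTT; rewrite -!leNgt => h1.
  by rewrite ge0_ler_powR ?(ltW p0) ?nnegrE ?nrm_ge0 ?powR_ge0.
exists n0; apply: nrm_lp_le => [|n]; first exact: ltW.
have [nn0|n0n] := leqP n n0.
  rewrite /psum big1 ?powR_ge0// => i _.
  by rewrite lpB lp_projE (leq_trans (ltn_ord i) nn0) subrr modulus0 powR0 ?gt_eqF.
set y : lp := x - lp_proj n0 x.
have yE i : y i = if (i < n0)%N then 0 else x i.
  by rewrite lpB lp_projE; case: ifP => _; rewrite ?subrr ?subr0.
clearbody y.
have : psum p x n0 + psum p y n <= psum p x n.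
  rewrite /psum -!(big_mkord xpredT (fun i => modulus (x i) `^ p)).
  rewrite -(big_mkord xpredT (fun i => modulus (y i) `^ p)).
  rewrite [leRHS](@big_cat_nat _ _ _ n0)/= ?(ltnW n0n)// lerD2l.
  rewrite (@big_cat_nat _ _ _ n0)/= ?(ltnW n0n)// big1_seq ?add0r; last first.
    move=> i; rewrite mem_index_iota /= => i0.
    by rewrite yE i0 modulus0 powR0 ?gt_eqF.
  rewrite le_eqVlt; apply/orP; left; apply/eqP; apply: eq_big_nat => i /andP[ni _].
  by rewrite yE ltnNge ni.
by have := psum_le_nrm x n; move: cn0; rewrite cp; lra.
Qed.

(** The operators [1 - P_n] are contractions, so that their pointwise convergence
    to zero is uniform on compact sets. *)
Lemma lp_proj_cvg_compact (A : set lp) (e : R) : compact A -> 0 < e ->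
  exists n0, forall n, (n0 <= n)%N -> forall x, A x -> nrm (x - lp_proj n x) < e.
Proof.
move=> cA e0.
have : \forall n \near \oo, A `<=` [set x | nrm (x - lp_proj n x) < e].
  move: cA => /compact_near_coveringP; apply => x Ax.
  have e2 : 0 < e / 2 by rewrite divr_gt0.
  have [n0 n0x] := lp_proj_cvg x e2.
  exists ([set y | `|x - y| < of_real (e / 2)], [set n | (n0 <= n)%N]).
    split => /=; last by exists n0.
    have /cvgrPdist_lt := @cvg_id _ (nbhs x); apply.
    by rewrite -[X in X < _](@of_real0 R k) ltr_of_real.
  move=> [y n] /= []; rewrite norm_lt_nrm => xy n0n.
  rewrite (_ : y - lp_proj n y = (y - x - lp_proj n (y - x)) + (x - lp_proj n x)); last first.
    by rewrite linearB/= -[LHS](subrK (x - lp_proj n x)); congr (_ + _);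
      rewrite opprD addrACA -opprD.
  rewrite (le_lt_trans (nrmD _ _))// (splitr e) ltr_leD ?n0x//.
  by rewrite (le_lt_trans (nrm_tail _ _))// nrmB.
by move=> [n0 _ n0A]; exists n0 => n n0n; exact: n0A.
Qed.

Lemma sum_ord_supp (F : nat -> R) d n : (forall i, 0 <= F i) ->
  (forall i, (d <= i)%N -> F i = 0) -> \sum_(i < n) F i <= \sum_(i < d) F i.
Proof.
move=> F0 Fd; rewrite -!(big_mkord xpredT F).
have [nd|dn] := leqP n d.
  by rewrite [leRHS](@big_cat_nat _ _ _ n)//= lerDl sumr_ge0.
rewrite [leLHS](@big_cat_nat _ _ _ d)//= ?(ltnW dn)//.
by rewrite gerDl big_nat_cond big1// => i /andP[/andP[/Fd]].
Qed.

Lemma schur_bounded_fin d (M : nat -> nat -> K) c :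
  (forall i j, (d <= i)%N || (d <= j)%N -> M i j = 0) ->
  \sum_(i < d) \sum_(j < d) modulus (M i j) <= c ->
  schur_bounded (fun=> d) M c.
Proof.
move=> Md Mc.
have row0 i : 0 <= \sum_(j < d) modulus (M i j).
  by apply: sumr_ge0 => j _; exact: modulus_ge0.
split=> [i|j n]; apply: le_trans Mc.
- have [di|id] := leqP d i.
    rewrite big1 ?sumr_ge0// => j _.
    by rewrite Md ?di// modulus0.
  by rewrite [leRHS](bigD1 (Ordinal id))//= lerDl sumr_ge0.
- apply: (le_trans (@sum_ord_supp (fun i => modulus (M i j)) d n _ _)) => [i|i di|].
  + exact: modulus_ge0.
  + by rewrite Md ?di// modulus0.
  + apply: ler_sum => i _; have [dj|jd] := leqP d j.
      by rewrite Md ?dj ?orbT// modulus0.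
    rewrite (bigD1 (Ordinal jd))//= lerDl sumr_ge0// => *; exact: modulus_ge0.
Qed.

Lemma fin_mx_op (d : nat) (Y : nat -> nat -> K) (c : R) : 0 < c ->
  \sum_(i < d) \sum_(j < d) modulus (Y i j) <= c ->
  exists2 g : bounded_op lp,
  (forall x i, g x i = if (i < d)%N then \sum_(j < d) Y i j * x j else 0) &
  opnorm g <= c.
Proof.
move=> c0 Yc.
pose M i j := if (i < d)%N && (j < d)%N then Y i j else 0.
have Ms : schur_bounded (fun=> d) M c.
  apply: schur_bounded_fin => [i j|].
    by rewrite /M; case: (ltnP i d); case: (ltnP j d).
  by apply: le_trans Yc; apply: ler_sum => i _; apply: ler_sum => j _; rewrite /M !ltn_ord.
have [g gM gc] := mx_op c0 Ms.
exists g => // x i; rewrite gM /mx_act /M; case: ifP => _; last first.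
  by rewrite big1// => j _; rewrite mul0r.
by apply: eq_bigr => j _; rewrite ltn_ord.
Qed.

Lemma fin_mx_subproof (d : nat) (Y : nat -> nat -> K) : exists g : bounded_op lp,
  forall x i, g x i = if (i < d)%N then \sum_(j < d) Y i j * x j else 0.
Proof.
pose s := \sum_(i < d) \sum_(j < d) modulus (Y i j).
have s0 : 0 <= s by do 2!apply: sumr_ge0 => ? _; exact: modulus_ge0.
have [||g gY _] := @fin_mx_op d Y (s + 1); rewrite -?/s; [lra|lra|].
by exists g.
Qed.

Definition fin_mx d Y : bounded_op lp := sval (cid (fin_mx_subproof d Y)).

Lemma fin_mxE d Y x i :
  fin_mx d Y x i = if (i < d)%N then \sum_(j < d) Y i j * x j else 0.
Proof. exact: (svalP (cid (fin_mx_subproof d Y))). Qed.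

Lemma opnorm_fin_mxB d (Y Z : nat -> nat -> K) (c : R) : 0 < c ->
  \sum_(i < d) \sum_(j < d) modulus (Y i j - Z i j) <= c ->
  opnorm (fin_mx d Y - fin_mx d Z) <= c.
Proof.
move=> c0 /(@fin_mx_op d (fun i j => Y i j - Z i j) c c0)[g gE gc]; rewrite (_ : _ - _ = g)//.
apply: bop_ext => x; apply: lp_ext => i; rewrite gE.
change ((fin_mx d Y x) i - (fin_mx d Z x) i =
  if (i < d)%N then \sum_(j < d) (Y i j - Z i j) * x j else 0).
rewrite !fin_mxE; case: ifP => _; last by rewrite subr0.
by rewrite -sumrB; apply: eq_bigr => j _; rewrite mulrBl.
Qed.

End LpOperators.

(** * A compactness criterion in l^p *)

Section Complex.
Lemma modulus_complexE (R : realType) (a b : R) :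
  @modulus R ComplexScalars (a +i* b)%C = Num.sqrt (a ^+ 2 + b ^+ 2).
Proof. by rewrite /modulus normc_def. Qed.

Lemma modulus_complex_le (R : realType) (a b : R) :
  @modulus R ComplexScalars (a +i* b)%C <= `|a| + `|b|.
Proof.
rewrite modulus_complexE -(ler_sqr (x := Num.sqrt _)) ?nnegrE ?sqrtr_ge0 ?addr_ge0//.
rewrite sqr_sqrtr ?addr_ge0 ?sqr_ge0// sqrrD !real_normK ?num_real//.
by rewrite -addrA lerD2l lerDr mulrn_wge0// mulr_ge0.
Qed.

Lemma normr_le_modulus (R : realType) (a b : R) :
  `|a| <= @modulus R ComplexScalars (a +i* b)%C /\
  `|b| <= @modulus R ComplexScalars (a +i* b)%C.
Proof.
by rewrite modulus_complexE -!sqrtr_sqr !ler_sqrt ?lerDl ?lerDr ?sqr_ge0 ?addr_ge0 ?sqr_ge0.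
Qed.
End Complex.

(** In the complex case the compact set is a square, the image of a compact
    subset of the real plane. *)
Lemma bounded_scalars_compact (R : realType) (k : scalar_kind) (c : R) :
  exists2 S : set (scalars R k), compact S & [set x | modulus x <= c] `<=` S.
Proof.
case: k => /=.
  exists `[- c, c]%classic; first exact: segment_compact.
  by move=> x /=; rewrite in_itv/= ler_norml.
exists ((fun z : R * R => (z.1 +i* z.2)%C : R[i]%C) @` (`[- c, c] `*` `[- c, c])).
  apply: continuous_compact; last by apply: compact_setX; exact: segment_compact.
  apply: continuous_subspaceT => z; apply/cvgrPdist_lt => e e0.
  have [r r0 er] := @gt0_of_real R ComplexScalars e e0.
  have r2 : 0 < r / 2 by rewrite divr_gt0.
  have H1 : \forall y \near z, `|z.1 - y.1| < r / 2.
    by apply: (@cvgr_dist_lt _ _ _ (nbhs z) _ (fun y : R * R => y.1)) => //; exact: cvg_fst.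
  have H2 : \forall y \near z, `|z.2 - y.2| < r / 2.
    by apply: (@cvgr_dist_lt _ _ _ (nbhs z) _ (fun y : R * R => y.2)) => //; exact: cvg_snd.
  near=> y.
  rewrite er -(@of_real_modulus R ComplexScalars) (@ltr_of_real R ComplexScalars).
  apply: (le_lt_trans (modulus_complex_le (z.1 - y.1) (z.2 - y.2))).
  by rewrite (splitr r) ltrD//; near: y.
move=> [a b] /= abc; exists (a, b) => //=.
have [ha hb] := normr_le_modulus a b.
by rewrite !in_itv/= -!ler_norml (le_trans ha abc) (le_trans hb abc).
Unshelve. all: by end_near. Qed.

Section LpCompactness.
Context {R : realType} {k : scalar_kind} {p : R} (p1 : 1 <= p).
Local Notation K := (scalars R k).
Local Notation lp := (lp k p1).

Let p0 : 0 < p. Proof. exact: lt_le_trans p1. Qed.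

(** The [l^p] norm is at most the [l^1] norm, as [x_i ^ p <= x_i * s ^ (p - 1)]
    if [s] is the sum of all the [x_i]. *)
Lemma nrm_le_sum (x : lp) m : (forall i, (m <= i)%N -> x i = 0) ->
  nrm x <= \sum_(i < m) modulus (x i).
Proof.
move=> xm; set s := \sum_(i < m) _.
have s0 : 0 <= s by apply: sumr_ge0 => i _; exact: modulus_ge0.
apply: nrm_lp_le => // n.
apply: le_trans (@sum_ord_supp _ (fun i => modulus (x i) `^ p) m n _ _) _.
- by move=> i; exact: powR_ge0.
- by move=> i mi; rewrite xm// modulus0 powR0// gt_eqF.
rewrite -(mulr_powRB1 s0 p0) /s mulr_suml; apply: ler_sum => i _.
rewrite -(mulr_powRB1 (modulus_ge0 _) p0) ler_wpM2l ?modulus_ge0//.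
rewrite ge0_ler_powR ?subr_ge0 ?nnegrE ?modulus_ge0//.
by rewrite (bigD1 i)//= lerDl sumr_ge0// => *; exact: modulus_ge0.
Qed.

Lemma cut_subproof m (y : nat -> K) :
  (fun i => if (i < m)%N then y i else 0) \in @lp_pred R k p p1.
Proof.
apply: (@lp_mem _ _ _ _ _ (psum p y m `^ p^-1)) => [|n]; first exact: powR_ge0.
have y0 : 0 <= psum p y m by apply: sumr_ge0 => *; exact: powR_ge0.
rewrite -powRrM mulVf ?gt_eqF// powRr1//.
apply: le_trans (@sum_ord_supp _ (fun i => modulus
  (if (i < m)%N then y i else 0) `^ p) m n _ _) _.
- by move=> i; exact: powR_ge0.
- by move=> i mi; rewrite ltnNge mi modulus0 powR0// gt_eqF.
by apply: ler_sum => i _; rewrite ltn_ord.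
Qed.

Definition cut m y : lp := Lp (cut_subproof m y).

(** Closed balls of [l^p] are closed for coordinatewise convergence; with [lp_mem],
    this shows that a coordinatewise limit of a bounded set lies in [l^p]. *)
Lemma psum_le_limit (y : nat -> K) (e : R) : 0 <= e ->
  (forall m d, 0 < d -> exists2 x : lp, nrm x <= e &
    forall i, (i < m)%N -> modulus (x i - y i) <= d) ->
  forall m, psum p y m <= e `^ p.
Proof.
move=> e0 ye m.
have -> : psum p y m = psum p (cut m y) m.
  by apply: eq_bigr => i _ /=; rewrite ltn_ord.
apply: le_trans (psum_le_nrm _ _) _.
rewrite ge0_ler_powR ?(ltW p0) ?nnegrE ?nrm_ge0//.
apply/ler_addgt0Pr => d d0.
have dm0 : 0 < d / m.+1%:R by rewrite divr_gt0.
have [x xe xy] := ye m _ dm0.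
rewrite -[cut m y](subrK (lp_proj p1 m x)) addrC.
rewrite (le_trans (nrmD _ _))// lerD ?(le_trans (nrm_lp_proj _ _))//.
apply: le_trans (nrm_le_sum (m := m) _) _ => [i mi|].
  by rewrite lpB lp_projE /= ltnNge mi/= subrr.
apply: (@le_trans _ _ (\sum_(i < m) d / m.+1%:R)).
  apply: ler_sum => i _; rewrite lpB lp_projE /= ltn_ord -modulusN opprB.
  exact: xy.
rewrite sumr_const card_ord -[leLHS]mulr_natr mulrAC ler_pdivrMr// ler_wpM2l ?(ltW d0)//.
by rewrite ler_nat.
Qed.

(** Let [B] be the set of points that satisfy the same bounds as [A] on the norm
    and on the tails. Along an ultrafilter containing [B] each coordinate is
    bounded, hence converges. The bounds pass to the limit by [psum_le_limit],
    and the uniform bounds on the tails turn coordinatewise convergence into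
    convergence in norm. *)
Lemma lp_precompact (A : set lp) (c : R) :
  (forall x, A x -> nrm x <= c) ->
  (forall e, 0 < e -> exists n, forall x, A x -> nrm (x - lp_proj p1 n x) <= e) ->
  precompact A.
Proof.
move=> Ac At.
pose B := [set x : lp | nrm x <= c /\ forall n e, 0 <= e ->
  (forall a, A a -> nrm (a - lp_proj p1 n a) <= e) -> nrm (x - lp_proj p1 n x) <= e].
have AB : A `<=` B by move=> x Ax; split; [exact: Ac|move=> n e _; exact].
suff cB : compact B.
  apply: precompact_subset AB _; rewrite precompact_closed//.
  by apply: compact_closed cB; exact: norm_hausdorff.
rewrite compact_ultra => F FU FB.
have c0 : 0 <= c by have /filter_ex[x [xc _]] := FB; exact: le_trans (nrm_ge0 x) xc.
have ycvg i : {y : K | forall d, 0 < d -> F [set x : lp | modulus (x i - y) <= d]}.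
  apply: cid; have [S cS Sc] := bounded_scalars_compact k c.
  have FS : ((fun x : lp => x i) @ F) S.
    apply: (@filterS _ F _ _ _ _ FB) => x [xc _]; apply: Sc.
    exact: le_trans (modulus_le_nrm x i) xc.
  have [y [_ yF]] := cS _ _ FS; exists y => d d0.
  have [//|Fn] := in_ultra_setVsetC [set x : lp | modulus (x i - y) <= d] FU.
  have od0 : 0 < of_real d :> K by rewrite -(@of_real0 R k) ltr_of_real.
  have [] := yF (~` [set z | modulus (z - y) <= d]) (ball y (of_real d)) Fn
    (nbhsx_ballx y _ od0).
  move=> z [/= zy]; rewrite -ball_normE/= -of_real_modulus ltr_of_real.
  by rewrite -modulusN opprB => /ltW.
pose y i := sval (ycvg i).
have Fy m d : 0 < d -> F [set x : lp | forall i, (i < m)%N -> modulus (x i - y i) <= d].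
  move=> d0; elim: m => [|m IHm]; first by apply: filterE.
  near=> x => i; rewrite ltnS leq_eqVlt => /predU1P[->|].
    by near: x; exact: (svalP (ycvg m)).
  by move: i; near: x.
have Fex m d : 0 < d -> exists2 x : lp, B x &
    forall i, (i < m)%N -> modulus (x i - y i) <= d.
  move=> d0; have [x [Bx xy]] := @filter_ex _ F _ _ (@filterI _ F _ _ _ FB (Fy m d d0)).
  by exists x.
have yin : y \in @lp_pred R k p p1.
  apply: (lp_mem _ c0); apply: psum_le_limit => // m d d0.
  have [x [xc _] xy] := Fex m d d0.
  by exists x.
pose z : lp := Lp yin.
have Bz : B z.
  split=> [|n e e0 An].
    apply: nrm_lp_le => //; apply: psum_le_limit => // m d d0.
    have [x [xc _] xy] := Fex m d d0.
    by exists x.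
  apply: nrm_lp_le => //; apply: psum_le_limit => // m d d0.
  have [x [_ xc] xy] := Fex m d d0.
  exists (x - lp_proj p1 n x); first exact: xc.
  move=> i im; rewrite !lpB !lp_projE /=; case: ifP => _.
    by rewrite !subrr modulus0 ltW.
  by rewrite !subr0; exact: xy.
exists z; split => //=; apply/cvgrPdist_le => e' /gt0_of_real[e e0 ->].
have e3 : 0 < e / 3 by rewrite divr_gt0.
have [n An] := At _ e3.
have en0 : 0 < e / 3 / n.+1%:R by rewrite divr_gt0.
apply: filterS2 FB (Fy n _ en0) => x [_ Bx] xy.
rewrite norm_le_nrm.
have -> : z - x = (z - lp_proj p1 n z) + (- (x - lp_proj p1 n x) + lp_proj p1 n (z - x)).
  rewrite (linearB (lp_proj p1 n))/= opprB [X in _ = _ + X]addrC.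
  by rewrite [X in _ = _ + X]addrA subrK addrA subrK.
rewrite (le_trans (nrmD _ _))// (_ : e = e / 3 + (e / 3 + e / 3)); last by field.
apply: lerD; first by apply: Bz.2 => //; exact: ltW.
rewrite (le_trans (nrmD _ _))// nrmN; apply: lerD; first by apply: Bx => //; exact: ltW.
apply: le_trans (nrm_le_sum (m := n) _) _ => [i mi|].
  by rewrite lp_projE ltnNge mi.
apply: (@le_trans _ _ (\sum_(i < n) e / 3 / n.+1%:R)).
  apply: ler_sum => i _; rewrite lp_projE ltn_ord lpB -modulusN opprB /=.
  exact: xy.
rewrite sumr_const card_ord -[leLHS]mulr_natr mulrAC ler_pdivrMr// ler_wpM2l ?(ltW e3)//.
by rewrite ler_nat.
Unshelve. all: by end_near. Qed.

End LpCompactness.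

(** * Density of finite matrices *)

Section Sections.
Context {R : realType} {k : scalar_kind} {p : R} (p1 : 1 <= p).
Local Notation K := (scalars R k).
Local Notation lp := (lp k p1).
Local Notation P := (lp_proj p1).

Let p0 : 0 < p. Proof. exact: lt_le_trans p1. Qed.

Lemma nrm_bop (E : normedModType K) (f : bounded_op E) x : nrm (f x) <= opnorm f * nrm x.
Proof. exact: le_opnorm. Qed.

Lemma lp_projS n (x : lp) : P n.+1 x = P n x + x n *: lp_basis k p1 n.
Proof.
apply: lp_ext => i; rewrite lpD lpZ !lp_projE.
change ((if (i < n.+1)%N then x i else 0) =
  (if (i < n)%N then x i else 0) + x n * (i == n)%:R).
rewrite ltnS leq_eqVlt; case: (ltngtP i n) => [_|_|->] /=.
- by rewrite mulr0 addr0.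
- by rewrite mulr0 addr0.
- by rewrite mulr1 add0r.
Qed.

Lemma lp_proj0 (x : lp) : P 0 x = 0.
Proof. by apply: lp_ext => i; rewrite lp_projE. Qed.

Definition finite_section (T : bounded_op lp) n : bounded_op lp :=
  fin_mx p1 n (fun i j => T (lp_basis k p1 j) i).

Lemma finite_sectionE T n x : finite_section T n x = P n (T (P n x)).
Proof.
apply: lp_ext => i; rewrite fin_mxE lp_projE; case: ifP => // _.
elim: n => [|n IHn]; first by rewrite lp_proj0 linear0 big_ord0.
by rewrite big_ord_recr/= IHn lp_projS linearD linearZ lpD lpZ mulrC.
Qed.

Lemma finite_section_compact (T : bounded_op lp) (A : set lp) (e : R) :
  compact A -> 0 < e ->
  exists n0, forall n, (n0 <= n)%N -> forall x, A x ->
    nrm (T x - finite_section T n x) < e.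
Proof.
move=> cA e0.
have cTA : compact (T @` A).
  by apply: continuous_compact cA; apply: continuous_subspaceT; exact: bop_continuous.
have e2 : 0 < e / 2 by rewrite divr_gt0.
have eT : 0 < e / 2 / (opnorm T + 1) by rewrite divr_gt0// ltr_wpDl// opnorm_ge0.
have [n1 n1A] := lp_proj_cvg_compact cA eT.
have [n2 n2A] := lp_proj_cvg_compact cTA e2.
exists (maxn n1 n2) => n; rewrite geq_max => /andP[n1n n2n] x Ax.
rewrite finite_sectionE.
have -> : T x - P n (T (P n x)) = (T x - P n (T x)) + P n (T (x - P n x)).
  by rewrite (linearB T) (linearB (P n)) addrA subrK.
rewrite (le_lt_trans (nrmD _ _))// (splitr e) ltr_leD//.
  by apply: n2A => //; exists x.
rewrite (le_trans (nrm_lp_proj _ _))// (le_trans (nrm_bop _ _))//.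
have := ltW (n1A _ n1n _ Ax); rewrite ler_pdivlMr ?ltr_wpDl ?opnorm_ge0// mulrC.
by apply: le_trans; rewrite ler_wpM2r ?nrm_ge0// lerDl.
Qed.

Lemma phase (a : K) : a != 0 -> exists2 u : K, modulus u = 1 & u * a = of_real (modulus a).
Proof.
move=> a0; exists (of_real (modulus a) / a); last by rewrite divfK.
by rewrite modulusM modulusV modulus_of_real ?modulus_ge0// divff// modulus_eq0.
Qed.

(** Otherwise there are, for every [N], [N] vectors of norm at most 1 with
    disjoint supports on which [phi] is at least [e]. Their sum has norm at most
    [N^(1/p)], and [phi] is at least [N e] on it, which contradicts the
    boundedness of [phi] for large [N], as [1 / p < 1]. *)
Lemma functional_tail (phi : lp -> K) (C e : R) : 1 < p ->
  (forall a x y, phi (a *: x + y) = a * phi x + phi y) ->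
  (forall x, modulus (phi x) <= C * nrm x) -> 0 < e ->
  exists n0, forall n, (n0 <= n)%N -> forall x,
    modulus (phi (x - P n x)) <= e * nrm x.
Proof.
move=> pgt1 phil phiC e0; apply/not_existsP => /= bad.
have C1 : 0 < `|C| + 1 by rewrite ltr_wpDl.
have phiC1 x : modulus (phi x) <= (`|C| + 1) * nrm x.
  rewrite (le_trans (phiC x))// ler_wpM2r ?nrm_ge0//.
  by rewrite (le_trans (ler_norm _))// lerDl.
have phi0 : phi 0 = 0.
  by apply: modulus0_eq0; apply/le_anti; rewrite modulus_ge0 andbT (le_trans (phiC _))// nrm0 mulr0.
have phiZ a x : phi (a *: x) = a * phi x.
  by rewrite -[a *: x]addr0 phil phi0 addr0.
have phiD x y : phi (x + y) = phi x + phi y.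
  by rewrite -[x]scale1r phil mul1r scale1r.
(* truncating a tail makes its support finite; a unimodular factor makes the
   value of phi positive *)
have unit n0 : exists2 u : lp, nrm u <= 1 & exists2 m,
    (forall i, (i < n0)%N || (m <= i)%N -> u i = 0) &
    exists2 r, phi u = of_real r & e <= r.
  have [n [x [n0n xbad]]] : exists n x, (n0 <= n)%N /\
      e * nrm x < modulus (phi (x - P n x)).
    have := bad n0; move=> /existsNP[n] /not_implyP[n0n] /existsNP[x] /negP.
    by rewrite -ltNge; exists n, x.
  have x0 : 0 < nrm x.
    rewrite lt_neqAle nrm_ge0 andbT eq_sym; apply: contraTneq xbad => x0.
    rewrite x0 mulr0 -leNgt (le_trans (phiC1 _))//.
    by rewrite (le_trans (ler_wpM2l (ltW C1) (nrm_tail _ _)))// x0 mulr0.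
  pose y := x - P n x.
  pose g := modulus (phi y) - e * nrm x.
  have g0 : 0 < g by rewrite subr_gt0.
  have [m /(_ m (leqnn _)) my] := lp_proj_cvg y (divr_gt0 g0 C1).
  pose z := P m y.
  have zx : nrm z <= nrm x.
    by rewrite (le_trans (nrm_lp_proj _ _))// nrm_tail.
  have zphi : e * nrm x <= modulus (phi z).
    have : modulus (phi (y - z)) <= g.
      by rewrite (le_trans (phiC1 _))// mulrC -ler_pdivlMr.
    have := modulusD (phi z) (phi (y - z)).
    rewrite -phiD addrC subrK /g; lra.
  have phiz0 : phi z != 0.
    by rewrite -modulus_gt0 (lt_le_trans _ zphi)// mulr_gt0.
  have [s s1 sphi] := phase phiz0.
  exists ((of_real (nrm x)^-1 * s) *: z).
    rewrite nrmZ modulusM s1 mulr1 modulus_of_real ?invr_ge0 ?nrm_ge0//.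
    by rewrite ler_pdivrMl// mulr1.
  exists m => [i i0|].
    rewrite lpZ /z lp_projE; case: ltnP => [im|]; last by rewrite mulr0.
    have ni : (i < n)%N.
      by case/orP: i0 => [/leq_trans->//|]; rewrite leqNgt im.
    by rewrite /y lpB lp_projE ni subrr mulr0.
  exists ((nrm x)^-1 * modulus (phi z)); last by rewrite ler_pdivlMl// mulrC.
  by rewrite phiZ -mulrA sphi of_realM.
(* the sum of N such vectors, each one starting where the previous one ends *)
have build N n0 : exists2 v : lp, forall j, psum p v j <= N%:R &
    (forall i, (i < n0)%N -> v i = 0) /\ exists2 r, phi v = of_real r & N%:R * e <= r.
  elim: N n0 => [|N IHN] n0.
    exists 0; last by split=> //; exists 0; rewrite ?mul0r// phi0 of_real0.
    move=> j; rewrite /psum big1// => i _.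
    by rewrite lp0 modulus0 powR0 ?gt_eqF.
  have [u u1 [m um [r ur er]]] := unit n0.
  have [v vN [vm [s vs es]]] := IHN (maxn m n0).
  exists (u + v).
    move=> j; apply: (@le_trans _ _ (psum p u j + psum p v j)).
      rewrite /psum -big_split; apply: ler_sum => i _; rewrite lpD.
      change (modulus (u i + v i) `^ p <= modulus (u i) `^ p + modulus (v i) `^ p).
      have [mi|im] := leqP m i.
        by rewrite um ?mi ?orbT// add0r modulus0 powR0 ?gt_eqF// add0r.
      by rewrite vm ?leq_max ?im// addr0 modulus0 [X in _ <= _ + X]powR0 ?gt_eqF// addr0.
    rewrite -natr1 addrC lerD//.
    rewrite (le_trans (psum_le_nrm _ _))//.
    have one : 1 `^ p = 1 :> R by rewrite powR1.
    by rewrite -[leRHS]one ge0_ler_powR ?nnegrE ?nrm_ge0 ?(ltW p0).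
  split=> [i i0|].
    by rewrite lpD um ?i0// vm ?leq_max ?i0 ?orbT// addr0.
  exists (r + s); first by rewrite phiD ur vs of_realD.
  by rewrite -natr1 mulrDl mul1r addrC lerD.
(* dividing [N e <= D N^(1/p)], raised to the power p, by N *)
pose D := `|C| + 1.
have NC N : N.+1%:R `^ (p - 1) <= (D / e) `^ p.
  have [v vN [_ [r vr Nr]]] := build N.+1 0%N.
  have N0 : 0 < N.+1%:R :> R by [].
  have nv : nrm v `^ p <= N.+1%:R.
    have q0 : 0 <= N.+1%:R `^ p^-1 :> R by exact: powR_ge0.
    have qE : (N.+1%:R `^ p^-1) `^ p = N.+1%:R :> R.
      by rewrite -powRrM mulVf ?gt_eqF// powRr1 ?ltW.
    rewrite -qE ge0_ler_powR ?(ltW p0) ?nnegrE ?nrm_ge0//.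
    by apply: nrm_lp_le => // n; rewrite qE.
  have r0 : 0 <= r by rewrite (le_trans _ Nr)// mulr_ge0 ?ltW.
  have rD : N.+1%:R <= D / e * nrm v.
    rewrite mulrAC ler_pdivlMr// (le_trans Nr)//.
    by rewrite -(@modulus_of_real R k r r0) -vr.
  have : N.+1%:R * N.+1%:R `^ (p - 1) <= N.+1%:R * (D / e) `^ p.
    have De : 0 <= D / e by rewrite divr_ge0 ?(ltW C1) ?(ltW e0).
    rewrite (mulr_powRB1 (ltW N0) p0).
    apply: le_trans (ge0_ler_powR (ltW p0) _ _ rD) _.
    - by rewrite nnegrE ltW.
    - by rewrite nnegrE mulr_ge0 ?nrm_ge0.
    by rewrite (powRM _ De (nrm_ge0 _)) mulrC ler_wpM2r ?powR_ge0.
  by rewrite ler_pM2l.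
have p10 : 0 < p - 1 by rewrite subr_gt0.
pose B := ((D / e) `^ p) `^ (p - 1)^-1.
have BE : B `^ (p - 1) = (D / e) `^ p.
  by rewrite -powRrM mulVf ?gt_eqF// powRr1 ?powR_ge0.
have [N BN] : exists N : nat, B < N.+1%:R.
  by exists (Num.truncn B); exact: truncnS_gt.
have := NC N; rewrite leNgt -BE.
by rewrite gt0_ltr_powR ?nnegrE ?powR_ge0.
Qed.

Lemma functional_tails (T : bounded_op lp) (m : nat) (e : R) : 1 < p -> 0 < e ->
  exists n0, forall n, (n0 <= n)%N -> forall i x, (i < m)%N ->
    modulus (T (x - P n x) i) <= e * nrm x.
Proof.
move=> pgt1 e0; elim: m => [|m [n1 IHm]]; first by exists 0%N.
have [||n2 n2T] := @functional_tail (fun x => T x m) (opnorm T) e pgt1 _ _ e0.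
- by move=> a x y; rewrite linearP.
- by move=> x; exact: le_trans (modulus_le_nrm _ _) (nrm_bop _ _).
exists (maxn n1 n2) => n; rewrite geq_max => /andP[n1n n2n] i x.
rewrite ltnS leq_eqVlt => /predU1P[->|im]; first exact: n2T.
exact: IHm.
Qed.

(** In [T - P T P = (T - P T) + P T (1 - P)] the first term is small since [T]
    maps the unit ball to a precompact set. For the same reason [T (1 - P)] is
    close to [P_m T (1 - P)] with [m] fixed, which only involves the [m] first
    coordinate functionals of [T], whose tails are small. *)
Lemma finite_section_cvg (T : bounded_op lp) (e : R) : 1 < p ->
  T \in @compact_op_pred K lp -> 0 < e ->
  exists n0, forall n, (n0 <= n)%N -> opnorm (T - finite_section T n) <= e.
Proof.
move=> pgt1 /asboolP; rewrite precompactE => cT e0.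
have e3 : 0 < e / 3 by rewrite divr_gt0.
have [m mT] := lp_proj_cvg_compact cT e3.
have {}mT n x : (m <= n)%N -> nrm x <= 1 -> nrm (T x - P n (T x)) <= e / 3.
  move=> mn x1; apply/ltW/mT => //; apply: subset_closure; exists x => //=.
  by rewrite nrm_le1.
have em0 : 0 < e / 3 / m.+1%:R by rewrite divr_gt0.
have [n1 n1T] := functional_tails T m pgt1 em0.
exists (maxn m n1) => n; rewrite geq_max => /andP[mn n1n].
apply: opnorm_le => x; rewrite nrm_le1 => x1.
change (nrm (T x - finite_section T n x) <= e).
rewrite finite_sectionE.
pose z := x - P n x.
have z1 : nrm z <= 1 by rewrite (le_trans (nrm_tail _ _)).
have -> : T x - P n (T (P n x)) = (T x - P n (T x)) + P n (T z).
  by rewrite (linearB T) (linearB (P n)) addrA subrK.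
rewrite (_ : e = e / 3 + (e / 3 + e / 3)); last by field.
rewrite (le_trans (nrmD _ _))// lerD ?mT// (le_trans (nrm_lp_proj _ _))//.
rewrite -[T z](subrK (P m (T z))) (le_trans (nrmD _ _))// lerD ?mT//.
apply: le_trans (nrm_le_sum (m := m) _) _ => [i mi|].
  by rewrite lp_projE ltnNge mi.
apply: (@le_trans _ _ (\sum_(i < m) e / 3 / m.+1%:R)).
  apply: ler_sum => i _; rewrite lp_projE ltn_ord.
  by rewrite (le_trans (n1T n n1n i x _))// ler_piMr// ltW.
rewrite sumr_const card_ord -[leLHS]mulr_natr mulrAC ler_pdivrMr//.
by rewrite ler_wpM2l ?(ltW e3)// ler_nat.
Qed.

End Sections.

(** * Separated sets of positive lower density *)

Section SeparatedLabels.
Local Open Scope nat_scope.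

(** The sum is the exponent of 2 in the factorial of [n]; by Legendre's formula it
    is at most [n / 2 + n / 4 + ...]. *)
Lemma sum_logn2 n : \sum_(1 <= s < n.+1) logn 2 s <= n.
Proof.
have -> : \sum_(1 <= s < n.+1) logn 2 s = logn 2 n`!.
  rewrite fact_prod; elim: n => [|n IHn]; first by rewrite !big_nil.
  rewrite !(big_nat_recr n.+1)//= IHn lognM//.
  by rewrite big_nat prodn_cond_gt0// => i /andP[].
rewrite logn_fact//.
have H m : \sum_(1 <= j < m.+1) n %/ 2 ^ j + n %/ 2 ^ m <= n.
  elim: m => [|m IHm]; first by rewrite big_geq// expn0 divn1.
  rewrite big_nat_recr//=; apply: leq_trans IHm; rewrite -addnA leq_add2l.
  rewrite expnSr divnMA; move: (n %/ 2 ^ m) => z; lia.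
by apply: leq_trans (H n); exact: leq_addr.
Qed.

Lemma logn2_odd a s : logn 2 (2 ^ a * s.*2.+1) = a.
Proof.
by rewrite lognM ?expn_gt0// pfactorK// logn_coprime ?addn0// prime_coprime// dvdn2 /= odd_double.
Qed.

(** Points are placed one after the other, each one at the centre of an interval
    of radius [N l] if [l] is its label; the label of the [t]-th point depends on
    the exponent [v] of 2 in [t], so that it recurs periodically. To [v] is
    attached the exponent [l] of 2 in [v] if [N l <= v], and 0 otherwise: the
    radius of the [t]-th interval is thus at most [N 0 + v]. As the average of
    [v] is bounded by [sum_logn2], the [t]-th point is placed at distance [O(t)]. *)
Lemma separated_labels (N : nat -> nat) : (forall l, 0 < N l) ->
  exists lab : nat -> option nat,
  [/\ forall t l, lab t = Some l -> N l <= t,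
      forall t t' l l', lab t = Some l -> lab t' = Some l' -> t < t' ->
        t + N l + N l' <= t' &
      forall l, exists K, exists2 u : nat -> nat, injective u &
        forall s, lab (u s) = Some l /\ u s <= K * s.+1].
Proof.
move=> N0.
(* label attached to the exponent v *)
pose g v := if N (logn 2 v) <= v then logn 2 v else 0.
pose wt t := N (g (logn 2 t)).
pose pos t := \sum_(1 <= s < t) 2 * wt s + wt t.
have posD t t' : 0 < t < t' -> pos t + wt t + wt t' <= pos t'.
  move=> /andP[t0 tt']; rewrite /pos [\sum_(1 <= s < t') _](@big_cat_nat _ _ _ t)//= ?(ltnW tt')//.
  rewrite [\sum_(t <= s < t') _]big_ltn//; lia.
have pos_lt t t' : 0 < t < t' -> pos t < pos t'.
  by move=> tt'; have := posD _ _ tt'; have := N0 (g (logn 2 t)); rewrite -/(wt t); lia.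
have pos_ge t : t <= pos t.
  elim: t => // -[|t] IHt; first by rewrite /pos big_geq// add0n /wt N0.
  by apply: leq_ltn_trans IHt _; apply: pos_lt; rewrite ltnS leqnn.
have pos_inj t t' : 0 < t -> 0 < t' -> pos t = pos t' -> t = t'.
  move=> t0 t'0 pp; case: (ltngtP t t') => // tt'.
    by have := pos_lt t t'; rewrite t0 tt' pp ltnn => /(_ isT).
  by have := pos_lt t' t; rewrite t'0 tt' pp ltnn => /(_ isT).
pose lab x := if [pick t : 'I_x.+1 | (0 < t) && (pos t == x)] is Some t
  then Some (g (logn 2 t)) else None.
have lab_pos t : 0 < t -> lab (pos t) = Some (g (logn 2 t)).
  move=> t0; rewrite /lab; case: pickP => [s /andP[s0 /eqP/pos_inj->]//|].
  have tp : t < (pos t).+1 by rewrite ltnS pos_ge.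
  by move=> /(_ (Ordinal tp)) /=; rewrite t0 eqxx.
have labP x l : lab x = Some l -> exists t, [/\ 0 < t, pos t = x & l = g (logn 2 t)].
  by rewrite /lab; case: pickP => // t /andP[t0 /eqP tx] [<-]; exists t.
exists lab; split.
- by move=> x l /labP[t [t0 <- ->]]; exact: leq_addl.
- move=> x x' l l' /labP[t [t0 <- ->]] /labP[t' [t'0 <- ->]] xx'.
  apply: posD; rewrite t0 /=; case: (ltngtP t t') => // tt'.
    by have := pos_lt t' t; rewrite t'0 tt' => /(_ isT); lia.
  by move: xx'; rewrite tt' ltnn.
(* the odd multiples of 2 ^ v are labelled l, as [N l <= v] and l is the exponent
   of 2 in v *)
- move=> l; pose v := 2 ^ l * (N l).*2.+1.
  have gv : g v = l.
    rewrite /g logn2_odd ifT// /v; have := expn_gt0 2 l; nia.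
  have wt_le t : wt t <= N 0 + logn 2 t.
    by rewrite /wt /g; case: ifP => h; [apply: leq_trans h _; exact: leq_addl|exact: leq_addr].
  have pos_le t : pos t <= (2 * (N 0).+1) * t + N 0 + logn 2 t.
    rewrite /pos -addnA leq_add ?wt_le//.
    have -> : \sum_(1 <= s < t) 2 * wt s = 2 * \sum_(1 <= s < t) wt s by rewrite big_distrr.
    rewrite -mulnA leq_mul2l /=; case: t => [|t]; first by rewrite big_geq.
    apply: leq_trans (leq_sum _ (fun s _ => wt_le s)) _.
    rewrite big_split/= sum_nat_const_nat.
    by have := sum_logn2 t; nia.
  exists (2 * (N 0).+1 * 2 ^ v.+1 + N 0 + v); exists (fun s => pos (2 ^ v * s.*2.+1)).
    move=> s s' /pos_inj; rewrite !muln_gt0 !expn_gt0/= => /(_ isT isT) /eqP.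
    by rewrite eqn_pmul2l ?expn_gt0// => /eqP[/double_inj].
  move=> s; split; first by rewrite lab_pos ?muln_gt0 ?expn_gt0//= logn2_odd gv.
  apply: leq_trans (pos_le _) _; rewrite logn2_odd expnS.
  have := expn_gt0 2 v; move: (2 ^ v) => w; nia.
Qed.

End SeparatedLabels.

(** * Iterates of the shifts and block diagonal matrices *)

Section ShiftIterates.
Context {R : realType} {k : scalar_kind} {p : R} (p1 : 1 <= p).
Local Notation K := (scalars R k).
Local Notation lp := (lp k p1).

Definition wprod (w : nat -> K) n : K := \prod_(1 <= l < n.+1) w l.

Lemma wprodS w n : wprod w n.+1 = wprod w n * w n.+1.
Proof. by rewrite /wprod big_nat_recr. Qed.

Lemma iter_sandwich (A T S : bounded_op lp) n x :
  iter n (sandwich A T) S x = iter n A (S (iter n T x)).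
Proof. by elim: n x => [//|n IHn] x; rewrite [iter n.+1 T x]iterSr /= -IHn. Qed.

Lemma iter_backward w (wP : bounded_weights w) n x a :
  (forall i, wprod w i != 0) ->
  iter n (backward_shift p1 wP) x a = wprod w (a + n) / wprod w a * x (a + n)%N.
Proof.
move=> w0; elim: n a => [|n IHn] a /=; first by rewrite addn0 divff// mul1r.
change (w a.+1 * iter n (backward_shift p1 wP) x a.+1 =
  wprod w (a + n.+1) / wprod w a * x (a + n.+1)%N).
have := w0 a.+1; rewrite IHn addSnnS wprodS mulf_eq0 negb_or => /andP[wa wa1].
move: (wprod w a) (w a.+1) (wprod w (a + n.+1)) (x (a + n.+1)%N) wa wa1.
by move=> u v z t u0 v0; rewrite invfM !mulrA [v * z]mulrC [z * v / u / v]mulrAC mulfK.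
Qed.

Lemma iter_forward mu (muP : bounded_weights mu) n x b :
  (forall i, wprod mu i != 0) ->
  iter n (forward_shift p1 muP) x b =
  if (n <= b)%N then wprod mu b / wprod mu (b - n) * x (b - n)%N else 0.
Proof.
move=> mu0; elim: n b => [|n IHn] b /=; first by rewrite subn0 divff// mul1r.
change (fshift_seq mu (iter n (forward_shift p1 muP) x) b =
  if (n < b)%N then wprod mu b / wprod mu (b - n.+1) * x (b - n.+1)%N else 0).
case: b => [//|b]; rewrite /fshift_seq IHn ltnS; case: ifP => _; last by rewrite mulr0.
by rewrite subSS wprodS !mulrA [mu b.+1 * _]mulrC.
Qed.

End ShiftIterates.

Section Blocks.
Context {R : realType} {k : scalar_kind}.
Local Notation K := (scalars R k).
(* [lab t = Some l] puts a block with target [y l], of size [d l], at position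
   [t ^ q] of the diagonal; [N l] is the room reserved for it. *)
Context (q : nat) (lab : nat -> option nat) (N d : nat -> nat).
Context (y : nat -> nat -> nat -> K) (W : nat -> nat -> K).
Hypothesis q0 : (0 < q)%N.
Hypothesis dN : forall l, (d l <= N l)%N.
Hypothesis labN : forall t l, lab t = Some l -> (N l <= t)%N.
Hypothesis lab_sep : forall t t' l l', lab t = Some l -> lab t' = Some l' ->
  (t < t')%N -> (t + N l + N l' <= t')%N.

Definition in_block t a : bool :=
  if lab t is Some l then (t ^ q <= a < t ^ q + N l)%N else false.

Lemma leq_exp_self t : (t <= t ^ q)%N.
Proof.
case: q q0 => // n _; case: t => // t; rewrite expnS.
by rewrite leq_pmulr// expn_gt0.
Qed.

Lemma expn_gap m t : (m <= t)%N -> (m ^ q + (t - m) <= t ^ q)%N.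
Proof.
case: q q0 => // n _ mt; rewrite !expnS -[t in (_ <= t * _)%N](subnKC mt) mulnDl.
have mtn : (m ^ n <= t ^ n)%N by case: n => // n; rewrite leq_exp2r.
rewrite leq_add ?leq_mul2l ?mtn ?orbT//.
by case: (posnP t) => [->|t0]; rewrite ?sub0n// leq_pmulr// expn_gt0 t0.
Qed.

Lemma in_block_inj t t' a : in_block t a -> in_block t' a -> t = t'.
Proof.
have H s s' : in_block s a -> in_block s' a -> ~~ (s < s')%N.
  rewrite /in_block; case E : (lab s) => [l|]//; case E' : (lab s') => [l'|]//.
  move=> /andP[sa as_] /andP[s'a as'_]; apply/negP => ss'.
  have := lab_sep E E' ss'; have := expn_gap (ltnW ss'); lia.
by move=> ta t'a; apply/eqP; rewrite eqn_leq; apply/andP; split; rewrite leqNgt H.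
Qed.

(** If [W i j] is [w_1 ... w_i mu_1 ... mu_j], the block of [t] is the preimage of
    its target under the iterate of order [t ^ q]. The search for [t] is bounded
    by [a] because [t <= t ^ q <= a]. *)
Definition diag_blocks a b : K :=
  if [pick t : 'I_a.+1 | in_block t a && in_block t b] is Some t
  then if lab t is Some l
    then W (a - t ^ q) (b - t ^ q) * y l (a - t ^ q)%N (b - t ^ q)%N / W a b
    else 0
  else 0.

Lemma diag_blocksE t l a b : lab t = Some l -> in_block t a -> in_block t b ->
  diag_blocks a b =
    W (a - t ^ q) (b - t ^ q) * y l (a - t ^ q)%N (b - t ^ q)%N / W a b.
Proof.
move=> tl ta tb; rewrite /diag_blocks; case: pickP => [s /andP[sa sb]|].
  by rewrite -(in_block_inj ta sa) tl.
have ta' : (t < a.+1)%N.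
  move: ta; rewrite /in_block tl ltnS => /andP[+ _].
  exact: leq_trans (leq_exp_self t).
by move=> /(_ (Ordinal ta')) /=; rewrite ta tb.
Qed.

Lemma diag_blocksP a b : diag_blocks a b != 0 -> exists t l,
  [/\ lab t = Some l, in_block t a & in_block t b].
Proof.
rewrite /diag_blocks; case: pickP => [t /andP[ta tb]|]; last by rewrite eqxx.
by case E : (lab t) => [l|]; [exists t, l|rewrite eqxx].
Qed.

(** A block at position [t ^ q] has size at most [t], hence [b < 2 * t ^ q] and
    [t ^ q <= a] in a block. *)
Lemma diag_blocks_supp a b : (a.*2 < b)%N -> diag_blocks a b = 0.
Proof.
move=> ab; apply/eqP; apply: contraTT ab => /diag_blocksP[t [l [tl]]].
rewrite /in_block tl => /andP[ta _] /andP[_ tb].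
have := labN tl; have := leq_exp_self t; lia.
Qed.

Lemma sum_window (f : nat -> R) s D c n : 0 <= c ->
  (forall b, f b <= if (s <= b < s + D)%N then c / D%:R else 0) ->
  \sum_(b < n) f b <= c.
Proof.
move=> c0 fs.
apply: (@le_trans _ _ (\sum_(b < n) if (s <= b < s + D)%N then c / D%:R else 0)).
  by apply: ler_sum => b _; exact: fs.
apply: (@le_trans _ _ (\sum_(b < s + D) if (s <= b < s + D)%N then c / D%:R else 0)).
  apply: (@sum_ord_supp _ (fun b => if (s <= b < s + D)%N then c / D%:R else 0) (s + D) n) => i.
    by case: ifP => // _; rewrite divr_ge0.
  by move=> si; rewrite [(i < _)%N]ltnNge si andbF.
rewrite big_split_ord/= big1 ?add0r; last first.
  by move=> i _; rewrite [(s <= i)%N]leqNgt ltn_ord.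
under eq_bigr do rewrite leq_addr ltn_add2l ltn_ord /=.
rewrite sumr_const card_ord -[leLHS]mulr_natr; case: D {fs} => [|D].
  by rewrite mulr0.
by rewrite divfK ?pnatr_eq0.
Qed.

(** No row or column meets two blocks, and a block has [d l] entries of size at
    most [c / d l] in each of its rows and columns. The shift [M] allows for a
    matrix read from position [M] of the diagonal. *)
Lemma blocks_schur (E : nat -> nat -> K) (M : nat) (c : R) h : 0 <= c ->
  (forall a b, E a b != 0 -> exists t l, [/\ lab t = Some l, (M <= t ^ q)%N,
    (t ^ q <= a + M < t ^ q + d l)%N, (t ^ q <= b + M < t ^ q + d l)%N &
    modulus (E a b) * (d l)%:R <= c]) ->
  schur_bounded h E c.
Proof.
move=> c0; have row (F : nat -> nat -> K) a n :
    (forall a b, F a b != 0 -> exists t l, [/\ lab t = Some l, (M <= t ^ q)%N,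
    (t ^ q <= a + M < t ^ q + d l)%N, (t ^ q <= b + M < t ^ q + d l)%N &
    modulus (F a b) * (d l)%:R <= c]) ->
    \sum_(b < n) modulus (F a b) <= c.
  move=> FP; have [Fa0|] := pselect (forall b, F a b = 0).
    by rewrite big1// => b _; rewrite Fa0 modulus0.
  move=> /existsNP[b0 /eqP/FP[t [l [tl Mt ta _ _]]]].
  have blk s l' x : lab s = Some l' -> (s ^ q <= x + M < s ^ q + d l')%N ->
      in_block s (x + M).
    move=> sl /andP[sx xs]; rewrite /in_block sl sx /=.
    by rewrite (leq_trans xs)// leq_add2l.
  apply: (@sum_window (fun b => modulus (F a b)) (t ^ q - M)%N (d l) c n c0) => b.
  have [->|/FP[t' [l' [tl' _ ta' tb' Fc]]]] := eqVneq (F a b) 0.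
    by rewrite modulus0; case: ifP => // _; rewrite divr_ge0.
  have tt' := in_block_inj (blk _ _ _ tl ta) (blk _ _ _ tl' ta').
  move: tl' ta' tb' Fc; rewrite -tt' tl => -[<-] _ tb Fc.
  rewrite ifT; last by lia.
  by rewrite ler_pdivlMr// ltr0n; lia.
move=> EP; split=> [a|b n]; first exact: row.
apply: (row (fun b a => E a b)) => {}a {}b /EP[t [l [h1 h2 h3 h4 h5]]].
by exists t, l.
Qed.

End Blocks.

(** * An operator whose orbit returns to every target *)

Section BlockOperator.
Context {R : realType} {k : scalar_kind} {p : R} (p1 : 1 <= p).
Local Notation K := (scalars R k).
Local Notation lp := (lp k p1).
Context (q : nat) (lab : nat -> option nat) (N d : nat -> nat).
Context (y : nat -> nat -> nat -> K) (w mu : nat -> K).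
Hypotheses (wP : bounded_weights w) (muP : bounded_weights mu).
Hypothesis q0 : (0 < q)%N.
Hypothesis N0 : forall l, (0 < N l)%N.
Hypothesis dN : forall l, (d l <= N l)%N.
Hypothesis labN : forall t l, lab t = Some l -> (N l <= t)%N.
Hypothesis lab_sep : forall t t' l l', lab t = Some l -> lab t' = Some l' ->
  (t < t')%N -> (t + N l + N l' <= t')%N.
Hypothesis y0 : forall l i j, (d l <= i)%N || (d l <= j)%N -> y l i j = 0.
Hypothesis w0 : forall i, wprod w i != 0.
Hypothesis mu0 : forall i, wprod mu i != 0.
Let W a b : K := wprod w a * wprod mu b.
Let eps (l : nat) : R := l.+1%:R^-1.
Hypothesis small : forall l l' n r i j, (l' <= l)%N -> (N l <= n)%N ->
  (i < d l')%N -> (j < d l')%N ->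
  modulus (W i j * y l' i j / W (i + ((n + r) ^ q - r ^ q))%N (j + ((n + r) ^ q - r ^ q))%N)
    * (d l')%:R <= eps l.

Let W0 a b : W a b != 0. Proof. by rewrite mulf_neq0. Qed.

Let eps_le l l' : (l <= l')%N -> eps l' <= eps l.
Proof. by move=> ll'; rewrite /eps lef_pV2 ?posrE// ler_nat ltnS. Qed.

Let eps_gt0 l : 0 < eps l. Proof. by rewrite /eps invr_gt0. Qed.

Local Notation X := (diag_blocks q lab N y W).

(* entry of a block, read from the position [m ^ q] of an earlier block *)
Let entry_small l m t l' a b : lab t = Some l' -> (m < t)%N ->
  (N l <= t - m)%N -> (N l' <= t - m)%N ->
  in_block q lab N t (a + m ^ q)%N -> in_block q lab N t (b + m ^ q)%N ->
  W (a + m ^ q)%N (b + m ^ q)%N / W a b * X (a + m ^ q)%N (b + m ^ q)%N != 0 ->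
  [/\ (t ^ q <= a + m ^ q < t ^ q + d l')%N, (t ^ q <= b + m ^ q < t ^ q + d l')%N &
   modulus (W (a + m ^ q)%N (b + m ^ q)%N / W a b * X (a + m ^ q)%N (b + m ^ q)%N) * (d l')%:R
     <= eps l].
Proof.
move=> tl' mt Nl Nl' ta tb; rewrite (diag_blocksE y W q0 lab_sep tl' ta tb).
move: ta tb; rewrite /in_block tl' => /andP[ta _] /andP[tb _].
have mq : (m ^ q <= t ^ q)%N by have := expn_gap q0 (ltnW mt); lia.
set i := (a + m ^ q - t ^ q)%N; set j := (b + m ^ q - t ^ q)%N.
have -> : W (a + m ^ q)%N (b + m ^ q)%N / W a b *
    (W i j * y l' i j / W (a + m ^ q)%N (b + m ^ q)%N) = W i j * y l' i j / W a b.
  by rewrite mulrC mulrA divfK.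
move=> nz; have : y l' i j != 0 by apply: contraNneq nz => ->; rewrite mulr0 mul0r.
have [id|di] := ltnP i (d l'); last by rewrite y0 ?di// eqxx.
have [jd|dj] := ltnP j (d l'); last by rewrite y0 ?dj ?orbT// eqxx.
move=> _; split; [by rewrite /i in id; lia|by rewrite /j in jd; lia|].
have aE : a = (i + ((t - m + m) ^ q - m ^ q))%N by rewrite subnK ?(ltnW mt)// /i; lia.
have bE : b = (j + ((t - m + m) ^ q - m ^ q))%N by rewrite subnK ?(ltnW mt)// /j; lia.
rewrite [in X in X <= _]aE [in X in X <= _]bE.
have [L [lL l'L NL]] : exists L, [/\ (l <= L)%N, (l' <= L)%N & (N L <= t - m)%N].
  by have [ll'|/ltnW l'l] := leqP l l'; [exists l'|exists l].
exact: le_trans (small _ l'L NL id jd) (eps_le lL).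
Qed.

(* the same for the matrix itself, which amounts to reading from position 0 *)
Let entry_small0 l t l' a b : lab t = Some l' -> (N l <= t)%N ->
  in_block q lab N t a -> in_block q lab N t b -> X a b != 0 ->
  [/\ (t ^ q <= a < t ^ q + d l')%N, (t ^ q <= b < t ^ q + d l')%N &
   modulus (X a b) * (d l')%:R <= eps l].
Proof.
move=> tl' Nt ta tb.
have := @entry_small l 0%N t l' a b tl'.
rewrite exp0n// !addn0 subn0 divff// mul1r; apply => //; last exact: labN.
exact: leq_trans Nt.
Qed.

(** Rows far down only meet blocks of large position, whose entries are small:
    the operator maps the unit ball to a set with uniformly small tails. *)
Lemma diag_op : exists D : compact_op lp,
  forall x a, D x a = mx_act (fun a => a.*2.+1) X x a.
Proof.
have X1 : schur_bounded (fun a => a.*2.+1) X 1.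
  apply: (@blocks_schur _ _ q lab N d q0 dN lab_sep X 0%N) => // a b Xab.
  have [t [l [tl ta tb]]] := diag_blocksP Xab.
  have [h1 h2 h3] := entry_small0 tl (labN tl) ta tb Xab.
  exists t, l; split; rewrite ?addn0// (le_trans h3)//.
  by rewrite invf_le1// ler1n.
have [g gX _] := @mx_op _ _ _ p1 _ _ _ ltr01 X1.
suff gc : g \in @compact_op_pred K lp by exists (CompactOp gc).
apply/asboolP; apply: (@lp_precompact _ _ _ _ _ (opnorm g)) => [_ [x x1 <-]|e e0].
  exact: le_opnorm1.
have [L Le] : exists L, eps L <= e.
  exists (Num.truncn e^-1); rewrite /eps -[leRHS]invrK lef_pV2 ?posrE ?invr_gt0//.
  exact/ltW/truncnS_gt.
exists (N L ^ q + N L)%N => _ [x x1 <-].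
pose n := (N L ^ q + N L)%N.
pose E a b := if (a < n)%N then 0 else X a b.
pose f : bounded_op lp := g - bop_comp (lp_proj p1 n) g.
have fx : nrm (f x) <= opnorm f.
  exact: le_opnorm1.
apply: le_trans fx (le_trans _ Le).
apply: (@opnorm_mx _ _ _ _ f (fun a => a.*2.+1) E) => [//||z a].
  apply: (@blocks_schur _ _ q lab N d q0 dN lab_sep E 0%N) => [|a b].
    exact: ltW.
  rewrite /E; case: ltnP => [|na Xab]; first by rewrite eqxx.
  have [t [l [tl ta tb]]] := diag_blocksP Xab.
  have NLt : (N L <= t)%N.
    rewrite leqNgt; apply/negP => tN.
    have tq : (t ^ q <= N L ^ q)%N by rewrite leq_exp2r// ltnW.
    by move: ta; rewrite /in_block tl; have := labN tl; rewrite /n in na; lia.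
  have [h1 h2 h3] := entry_small0 tl NLt ta tb Xab.
  by exists t, l; split; rewrite ?addn0.
change (g z a - lp_proj p1 n (g z) a = mx_act (fun a => a.*2.+1) E z a).
rewrite lp_projE gX /mx_act /E; case: ltnP => an; last by rewrite subr0.
by rewrite subrr big1// => b _; rewrite mul0r.
Qed.

Lemma sum_ord_widen (F : nat -> K) m n : (m <= n)%N ->
  (forall i, (m <= i)%N -> F i = 0) -> \sum_(i < n) F i = \sum_(i < m) F i.
Proof.
move=> mn Fm; rewrite -!(big_mkord xpredT F).
rewrite [LHS](@big_cat_nat _ _ _ m)//= [X in _ + X]big_nat_cond.
by rewrite [X in _ + X]big1 ?addr0// => i /andP[/andP[/Fm]].
Qed.

(** The iterate of order [m ^ q] reads the matrix from position [m ^ q]: the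
    blocks of [t < m] end before it, the block of [m] is the target [y l], and the
    blocks of [t > m] are bounded by [entry_small]. *)
Lemma orbit_close : exists D : compact_op lp, forall l m, lab m = Some l ->
  opnorm (iter (m ^ q) (sandwich (backward_shift p1 wP) (forward_shift p1 muP)) D
    - fin_mx p1 (d l) (y l)) <= eps l.
Proof.
have [D DX] := diag_op; exists D => l m ml; set M := (m ^ q)%N.
pose E a b := W (a + m ^ q)%N (b + m ^ q)%N / W a b * X (a + m ^ q)%N (b + m ^ q)%N - y l a b.
pose H a := ((a + M).*2.+1 + d l)%N.
apply: (@opnorm_mx _ _ _ _ _ H E) => [//||x a].
  apply: (@blocks_schur _ _ q lab N d q0 dN lab_sep E M) => [|a b Eab].
    exact: ltW.
  have ymb t : in_block q lab N t (a + m ^ q)%N -> in_block q lab N t (b + m ^ q)%N ->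
      t <> m -> y l a b = 0.
    move=> ta tb tm; apply: y0.
    have [ad|//] := ltnP a (d l); exfalso; apply: tm.
    apply: (in_block_inj q0 lab_sep ta).
    by rewrite /in_block ml; have := dN l; lia.
  have [X0|Xn0] := eqVneq (X (a + m ^ q)%N (b + m ^ q)%N) 0.
    have yab : y l a b != 0.
      by move: Eab; rewrite /E X0 mulr0 add0r oppr_eq0.
    have [ad|ad] := ltnP a (d l); last by rewrite y0 ?ad// eqxx in yab.
    have [bd|bd] := ltnP b (d l); last by rewrite y0 ?bd ?orbT// eqxx in yab.
    have im x : (x < d l)%N -> in_block q lab N m (x + m ^ q)%N.
      by move=> xd; rewrite /in_block ml; have := dN l; lia.
    move: X0; rewrite (diag_blocksE y W q0 lab_sep ml (im a ad) (im b bd)) !addnK.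
    by move/eqP; rewrite (negbTE (mulf_neq0 (mulf_neq0 (W0 _ _) yab) (invr_neq0 (W0 _ _)))).
  have [t [l' [tl' ta tb]]] := diag_blocksP Xn0.
  case: (ltngtP m t) => [mt|tm|mt].
  - have sep := lab_sep ml tl' mt.
    have Ny : y l a b = 0 by apply: (ymb t) => // tm; rewrite tm ltnn in mt.
    have EE : E a b = W (a + m ^ q)%N (b + m ^ q)%N / W a b * X (a + m ^ q)%N (b + m ^ q)%N.
      by rewrite /E Ny subr0.
    have [|||h1 h2 h3] := @entry_small l m t l' a b tl' mt _ _ ta tb.
    + by lia.
    + by lia.
    + by rewrite -EE.
    exists t, l'; split => //; last by rewrite EE.
    by have := expn_gap q0 (ltnW mt); rewrite /M; lia.
  - exfalso; have := lab_sep tl' ml tm; have := expn_gap q0 (ltnW tm).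
    by move: ta; rewrite /in_block tl'; lia.
  - exfalso; move: Eab; rewrite /E; move: tl'; rewrite -mt ml => -[ll'].
    rewrite -mt in ta tb.
    rewrite (diag_blocksE y W q0 lab_sep ml ta tb) !addnK.
    by rewrite mulrC mulrA divfK// [W a b * _]mulrC mulfK// subrr eqxx.
change (iter (m ^ q) (sandwich (backward_shift p1 wP) (forward_shift p1 muP)) D x a
  - fin_mx p1 (d l) (y l) x a = mx_act H E x a).
rewrite iter_sandwich iter_backward// DX /mx_act -/M.
rewrite fin_mxE.
have -> : (if (a < d l)%N then \sum_(j < d l) y l a j * x j else 0) =
    \sum_(j < H a) y l a j * x j.
  rewrite (@sum_ord_widen (fun j => y l a j * x j) (d l) (H a)) ?leq_addl//; last first.
    by move=> j dj; rewrite y0 ?dj ?orbT// mul0r.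
  case: ltnP => // da; rewrite big1// => j _.
  by rewrite y0 ?da// mul0r.
pose G b := X (a + M)%N b * iter M (forward_shift p1 muP) x b.
have -> : \sum_(b < (a + M).*2.+1) X (a + M)%N b * iter M (forward_shift p1 muP) x b =
    \sum_(b < M + H a) G b.
  rewrite [RHS](@sum_ord_widen G (a + M).*2.+1)// => [|b hb].
    by rewrite /H; lia.
  by rewrite /G (diag_blocks_supp y W q0 labN)// mul0r.
rewrite big_split_ord/= big1 ?add0r; last first.
  by move=> b _; rewrite /G iter_forward//= leqNgt ltn_ord mulr0.
rewrite mulr_sumr -sumrB; apply: eq_bigr => b _.
rewrite /G iter_forward//= leq_addr addKn /E mulrBl -/M addnC; congr (_ - _).
rewrite [(M + a)%N]addnC [(M + b)%N]addnC /W.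
move: (X _ _) (x b) (wprod w (a + M)) (wprod mu (b + M)) (wprod w a) (wprod mu b).
by move=> u1 u2 u3 u4 u5 u6; rewrite invfM; ring.
Qed.

End BlockOperator.

(** * Targets and widths *)

Section Enumeration.
Context {R : realType} {k : scalar_kind}.
Local Notation K := (scalars R k).

Lemma rat_dense (x e : R) : 0 < e -> exists r : rat, `|x - ratr r| <= e.
Proof.
move=> e0; have [|r] := @rat_in_itvoo R (x - e) (x + e); first by lra.
rewrite in_itv/= => /andP[r1 r2]; exists r; rewrite ler_norml; lra.
Qed.

Lemma dense_scalars : exists s : nat -> K,
  forall x e, 0 < e -> exists n, modulus (x - s n) <= e.
Proof.
case: k => /=.
  exists (fun n => if @unpickle rat n is Some r then ratr r else 0) => x e e0.
  by have [r xr] := rat_dense x e0; exists (pickle r); rewrite pickleK.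
exists (fun n => if @unpickle (rat * rat)%type n is Some (r, s)
  then (complex.Complex (ratr r) (ratr s)) else 0) => -[a b] e e0.
have e2 : 0 < e / 2 by rewrite divr_gt0.
have [r ar] := rat_dense a e2; have [s bs] := rat_dense b e2.
exists (pickle (r, s)); rewrite pickleK.
apply: le_trans (modulus_complex_le (a - ratr r) (b - ratr s)) _.
by rewrite (splitr e) lerD.
Qed.

(** The size and the entries, taken from a countable dense set of scalars, are
    coded by the exponent of 2 in [l]; as this leaves the odd part of [l] free,
    every code is used for arbitrarily large [l]. *)
Lemma dense_finite_matrices : exists (d : nat -> nat) (y : nat -> nat -> nat -> K),
  (forall l i j, (d l <= i)%N || (d l <= j)%N -> y l i j = 0) /\
  forall (n : nat) (Y : nat -> nat -> K) (e : R) (L : nat), 0 < e ->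
    exists l, [/\ (L <= l)%N, d l = n &
      \sum_(i < n) \sum_(j < n) modulus (y l i j - Y i j) <= e].
Proof.
have [s sP] := dense_scalars.
pose code l : nat * seq nat := odflt (0%N, [::]) (unpickle (logn 2 l)).
pose d l := (code l).1.
pose y l i j : K := if (i < d l)%N && (j < d l)%N
  then s (nth 0%N (code l).2 (i * d l + j)) else 0.
exists d, y; split=> [l i j|n Y e L e0].
  by rewrite /y; case: (ltnP i (d l)); case: (ltnP j (d l)).
have en0 : 0 < e / (n * n).+1%:R by rewrite divr_gt0.
pose c i j := sval (cid (sP (Y i j) _ en0)).
have cP i j : modulus (Y i j - s (c i j)) <= e / (n * n).+1%:R.
  exact: (svalP (cid (sP (Y i j) _ en0))).
pose t := (n, mkseq (fun a => c (a %/ n)%N (a %% n)%N) (n * n)).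
exists (2 ^ pickle t * L.*2.+1)%N.
have codeE : code (2 ^ pickle t * L.*2.+1)%N = t.
  by rewrite /code logn2_odd pickleK.
split.
- have := expn_gt0 2 (pickle t); nia.
- by rewrite /d codeE.
apply: (@le_trans _ _ (\sum_(i < n) \sum_(j < n) e / (n * n).+1%:R)).
  apply: ler_sum => i _; apply: ler_sum => j _.
  have ij : (i * n + j < n * n)%N.
    by have := ltn_ord i; have := ltn_ord j; nia.
  have n0 : (0 < n)%N := leq_ltn_trans (leq0n _) (ltn_ord i).
  rewrite -modulusN opprB /y /d codeE /= !ltn_ord /= nth_mkseq//.
  by rewrite divnMDl// divn_small// addn0 modnMDl modn_small.
rewrite !sumr_const !card_ord -mulrnA -[leLHS]mulr_natr mulrAC ler_pdivrMr//.
by rewrite ler_wpM2l ?(ltW e0)// ler_nat.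
Qed.

Lemma near_bounded_forall (Q : nat -> nat -> Prop) m :
  (forall i, (i < m)%N -> \forall n \near \oo, Q i n) ->
  \forall n \near \oo, forall i, (i < m)%N -> Q i n.
Proof.
elim: m => [|m IHm] mQ; first by near=> n.
have h1 := IHm (fun i im => mQ i (ltnW im)); have h2 := mQ m (ltnSn m).
apply: filterS2 h1 h2 => n h1 h2 i.
by rewrite ltnS leq_eqVlt => /predU1P[->|/h1].
Unshelve. all: by end_near. Qed.

End Enumeration.

Section Density.
Context {R : realType}.

Lemma count_upto_ge (M : set nat) (u : nat -> nat) (S m : nat) :
  injective u -> (forall s, (s < S)%N -> M (u s) /\ (u s <= m)%N) ->
  (S <= count_upto M m)%N.
Proof.
move=> ui uM; pose f (s : 'I_S) : 'I_m.+1 := inord (u s).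
have fE s : f s = u s :> nat by rewrite inordK// ltnS (uM s (ltn_ord s)).2.
have fi : injective f.
  by move=> s t /(congr1 (@nat_of_ord _)); rewrite !fE => /ui/val_inj.
rewrite -[S in (S <= _)%N]card_ord -(card_codom fi) /count_upto.
apply: subset_leq_card; apply/fintype.subsetP => _ /codomP[s ->].
by rewrite inE fE; exact: (uM s (ltn_ord s)).1.
Qed.

Lemma limn_einf_gt0 (a : nat -> \bar R) (c : R) n0 : 0 < c ->
  (forall n, (n0 <= n)%N -> (c%:E <= a n)%E) -> (0 < limn_einf a)%E.
Proof.
move=> c0 ca; apply: (@lt_le_trans _ _ c%:E); first by rewrite lte_fin.
rewrite limn_einf_lim; apply: lime_ge; first exact: is_cvg_einfs.
exists n0 => // n /= n0n; apply: le_ereal_inf_tmp => _ [m /= nm <-].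
by apply: ca; exact: leq_trans nm.
Qed.

(** If [u s <= C * s.+1], at least [N %/ C] of the return times [u s ^ q] are at
    most [N ^ q]. *)
Lemma q_frequently_hypercyclic_of_orbit (K : numDomainType) (E : topologicalLmodType K)
  (q : nat) (A : E -> E) (x : E) : (0 < q)%N -> linear A -> continuous A ->
  (forall V : set E, open V -> V !=set0 -> exists C, exists2 u : nat -> nat,
    injective u & forall s, [/\ (0 < u s)%N, (u s <= C * s.+1)%N &
      V (iter (u s ^ q) A x)]) ->
  q_frequently_hypercyclic R E q A.
Proof.
move=> q0 Al Ac Ax; split => //; exists x => V oV V0.
have [C [u ui uP]] := Ax V oV V0.
have C0 : (0 < C)%N.
  by have [h1 h2 _] := uP 0%N; rewrite muln1 in h2; exact: leq_trans h2.
apply: (@limn_einf_gt0 _ (2 * C)%:R^-1 C) => [|n Cn].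
  by rewrite invr_gt0 ltr0n muln_gt0.
have n0 : (0 < n)%N by exact: leq_trans Cn.
rewrite lee_fin ler_pdivlMr ?ltr0n// mulrC ler_pdivrMr ?ltr0n ?muln_gt0//.
rewrite -natrM ler_nat.
have : (n %/ C <= count_upto [set n | (0 < n)%N /\ V (iter n A x)] (n ^ q))%N.
  apply: (@count_upto_ge _ (fun s => u s ^ q)%N) => [s t|s sn].
    by move=> /eqP; rewrite eqn_exp2r// => /eqP/ui.
  have [u0 us Vs] := uP s; split; first by split => //; rewrite expn_gt0 u0.
  rewrite leq_exp2r// (leq_trans us)// (leq_trans _ (leq_divM n C))//.
  by rewrite mulnC leq_mul2r sn orbT.
have := divn_eq n C; have := ltn_pmod n C0.
have := divn_gt0 n C0; rewrite Cn.
move: (n %/ C)%N (n %% C)%N (count_upto _ _) => a b c; nia.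
Qed.

End Density.

Section Orbit.
Context {R : realType} {k : scalar_kind}.
Local Notation K := (scalars R k).

Lemma wprod_neq0 (w : nat -> K) m a : wprod w (m + a) != 0 -> wprod w a != 0.
Proof.
elim: m => // m IHm; rewrite addSn wprodS mulf_eq0 negb_or => /andP[/IHm].
by [].
Qed.

(** For fixed [l] the bound concerns the finitely many entries of [y_0, ..., y_l],
    so that the limits of the weight products give a common threshold [N l],
    valid for all [r]. *)
Lemma block_widths (q : nat) (d : nat -> nat) (y : nat -> nat -> nat -> K)
    (W : nat -> nat -> K) :
  (forall (i j : nat) (M : R), \forall n \near \oo, forall r : nat,
    M <= modulus (W ((n + r) ^ q - r ^ q + i) ((n + r) ^ q - r ^ q + j))%N) ->
  exists N : nat -> nat, [/\ forall l, (0 < N l)%N, forall l, (d l <= N l)%N &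
    forall l l' n r i j, (l' <= l)%N -> (N l <= n)%N -> (i < d l')%N -> (j < d l')%N ->
    modulus (W i j * y l' i j / W (i + ((n + r) ^ q - r ^ q)) (j + ((n + r) ^ q - r ^ q)))%N
      * (d l')%:R <= l.+1%:R^-1].
Proof.
move=> Wlim.
have H l : exists n0, forall n, (n0 <= n)%N -> forall l', (l' < l.+1)%N ->
    forall i, (i < d l')%N -> forall j, (j < d l')%N -> forall r,
    modulus (W i j * y l' i j / W (i + ((n + r) ^ q - r ^ q)) (j + ((n + r) ^ q - r ^ q)))%N
      * (d l')%:R <= l.+1%:R^-1.
  suff [n0 _ n0P] : \forall n \near \oo, forall l', (l' < l.+1)%N ->
    forall i, (i < d l')%N -> forall j, (j < d l')%N -> forall r,
    modulus (W i j * y l' i j / W (i + ((n + r) ^ q - r ^ q)) (j + ((n + r) ^ q - r ^ q)))%N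
      * (d l')%:R <= l.+1%:R^-1 by exists n0 => n /n0P.
  apply: near_bounded_forall => l' _; apply: near_bounded_forall => i _.
  apply: near_bounded_forall => j _.
  pose c := modulus (W i j * y l' i j) * (d l')%:R.
  have c0 : 0 <= c by rewrite mulr_ge0 ?modulus_ge0.
  apply: filterS (Wlim i j (c * l.+1%:R + 1)) => n nW r.
  rewrite (addnC i) (addnC j); set v := W ((n + r) ^ q - r ^ q + i)%N _.
  have v0 : 0 < modulus v by rewrite (lt_le_trans _ (nW r))// ltr_wpDl// mulr_ge0.
  rewrite modulusM modulusV mulrAC -/c ler_pdivrMr// mulrC ler_pdivlMr ?ltr0n//.
  by rewrite (le_trans _ (nW r))// lerDl.
pose N l := maxn (maxn (sval (cid (H l))) (d l)) 1.
exists N; split=> [l|l|l l' n r i j l'l Nn id jd].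
- by rewrite /N leq_max orbT.
- by rewrite /N !leq_max leqnn orbT.
- apply: (svalP (cid (H l))) => //.
  by apply: leq_trans Nn; rewrite /N !leq_max leqnn.
Qed.

(** The part of the argument common to the three topologies. A term [y l] close
    to [Y] with [l] large is visited up to [1 / (l + 1)] at the times [t ^ q],
    for [t] labelled [l]. *)
Lemma dense_orbit (p : R) (p1 : 1 <= p) (q : nat) (w mu : nat -> K)
    (wP : bounded_weights w) (muP : bounded_weights mu) : (0 < q)%N ->
  (forall (i j : nat) (M : R), \forall n \near \oo, forall r : nat,
    M <= modulus (wprod w ((n + r) ^ q - r ^ q + i) *
                  wprod mu ((n + r) ^ q - r ^ q + j))) ->
  exists D : compact_op (lp k p1), forall n (Y : nat -> nat -> K) (e : R), 0 < e ->
    exists C, exists2 u : nat -> nat, injective u & forall s,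
    [/\ (0 < u s)%N, (u s <= C * s.+1)%N & opnorm (iter (u s ^ q)
      (sandwich (backward_shift p1 wP) (forward_shift p1 muP)) D - fin_mx p1 n Y) <= e].
Proof.
move=> q0 lim.
have w_mu0 a : (wprod w a != 0) && (wprod mu a != 0).
  have [n0 _ /(_ n0 (leqnn _) 0%N)] := lim a a 1.
  move=> /(lt_le_trans ltr01); rewrite modulus_gt0 mulf_eq0 negb_or => /andP[wa mua].
  by rewrite (wprod_neq0 wa) (wprod_neq0 mua).
have w0 a : wprod w a != 0 by have /andP[] := w_mu0 a.
have mu0 a : wprod mu a != 0 by have /andP[] := w_mu0 a.
have [d [y [y0 yP]]] := @dense_finite_matrices R k.
have [N [N0 dN small]] := @block_widths q d y (fun a b => wprod w a * wprod mu b) lim.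
have [lab [labN lab_sep labD]] := separated_labels N0.
have [D DP] := @orbit_close R k p p1 q lab N d y w mu wP muP q0 N0 dN labN lab_sep y0 w0 mu0 small.
exists D => n Y e e0.
have e2 : 0 < e / 2 by rewrite divr_gt0.
have [l [Ll dl lY]] := yP n Y _ (Num.truncn (e / 2)^-1) e2.
have [C [u ui uP]] := labD l; exists C, u => // s; have [ul us] := uP s.
split => //; first exact: leq_trans (N0 l) (labN _ _ ul).
rewrite -[_ - _](subrKA (fin_mx p1 n (y l))) (splitr e).
rewrite (le_trans (opnormD _ _))// lerD//; last exact: opnorm_fin_mxB.
have := DP _ _ ul; rewrite dl => /le_trans; apply.
rewrite -[leRHS]invrK lef_pV2 ?posrE ?invr_gt0 ?ltr0n//.
apply: le_trans (ltW (truncnS_gt _)) _.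
by rewrite ler_nat ltnS.
Qed.

End Orbit.

(** * Open sets of operators *)

Section OperatorTopologies.
Context {R : realType} {k : scalar_kind} {p : R} (p1 : 1 <= p).
Local Notation K := (scalars R k).
Local Notation lp := (lp k p1).

Lemma opnorm_comp (f g : bounded_op lp) : opnorm (bop_comp f g) <= opnorm f * opnorm g.
Proof.
apply: opnorm_le_nrm => [|x]; first by rewrite mulr_ge0 ?opnorm_ge0.
rewrite (le_trans (nrm_bop f (g x)))// -mulrA ler_wpM2l ?opnorm_ge0//.
exact: nrm_bop.
Qed.

Lemma opnormB (f g : bounded_op lp) : opnorm (f - g) = opnorm (g - f).
Proof. by rewrite -[f - g]opprB -scaleN1r opnormZ modulusN modulus1 mul1r. Qed.

Lemma sandwich_linear (A T : bounded_op lp) : linear (sandwich A T).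
Proof.
move=> a f g; apply: bop_ext => x.
by change (A (a *: f (T x) + g (T x)) = a *: A (f (T x)) + A (g (T x))); rewrite linearP.
Qed.

Lemma compact_nrm_bounded (A : set lp) : compact A ->
  exists2 c, 0 < c & forall x, A x -> nrm x < c.
Proof.
move=> cA.
have : \forall n \near \oo, A `<=` [set x | nrm x < n.+1%:R].
  move: cA => /compact_near_coveringP; apply => x Ax.
  exists ([set y | `|x - y| < of_real 1], [set n | (Num.truncn (nrm x + 1) <= n)%N]).
    split => /=; last by exists (Num.truncn (nrm x + 1)).
    have /cvgrPdist_lt := @cvg_id _ (nbhs x); apply.
    by rewrite -[X in X < _](@of_real0 R k) ltr_of_real.
  move=> [y n] /= []; rewrite norm_lt_nrm nrmB => xy n0n.
  rewrite -[y](subrK x) addrC (le_lt_trans (nrmD _ _))//.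
  apply: (@lt_trans _ _ (nrm x + 1)); first by rewrite ltrD2l.
  by rewrite (lt_le_trans (truncnS_gt _))// ler_nat ltnS.
by move=> [n _ /(_ n (leqnn _)) An]; exists n.+1%:R.
Qed.

(** Points are compact. *)
Lemma nbhs_SOT_COT (T : bounded_op lp) :
  nbhs (T : operators_SOT lp) `<=` nbhs (T : operators_COT lp).
Proof.
apply: (@SOT_cvgP _ _ (nbhs (T : operators_COT lp) : set_system (operators_SOT lp)) T _).2.
move=> x; apply/cvgrPdist_lt => e e0.
have := COT_nbhs T (@compact_set1 _ x) e0; apply: filterS => f; exact.
Qed.

Lemma COT_finite_section (T : bounded_op lp) (V : set (bounded_op lp)) :
  nbhs (T : operators_COT lp) V -> exists n, V (finite_section T n).
Proof.
have h : (fun n => finite_section T n : operators_COT lp) @ \oo -->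
    (T : operators_COT lp).
  apply/COT_cvgP => A cA e /gt0_of_real[r r0 ->].
  have [n0 n0P] := finite_section_compact T cA r0.
  by exists n0 => // n /= n0n x Ax; rewrite norm_lt_nrm; exact: n0P.
by move=> /h [n _ /(_ n (leqnn _)) Vn]; exists n.
Qed.

(** Compact sets are bounded. *)
Lemma COT_opnorm_ball (Y : bounded_op lp) (V : set (bounded_op lp)) :
  nbhs (Y : operators_COT lp) V ->
  exists2 e, 0 < e & forall S, opnorm (S - Y) <= e -> V S.
Proof.
pose F : set_system (operators_COT lp) :=
  filter_from [set e : R | 0 < e] (fun e => [set S | opnorm (S - Y) <= e]).
have FF : Filter F.
  apply: filter_from_filter; first by exists 1 => /=.
  move=> a b /= a0 b0; exists (Num.min a b); first by rewrite /= lt_min a0.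
  by move=> S /=; rewrite le_min => /andP[].
suff FY : F --> (Y : operators_COT lp).
  by move=> /FY [e e0 eV]; exists e => // S; exact: eV.
apply/COT_cvgP => A cA e /gt0_of_real[r r0 ->].
have [c c0 Ac] := compact_nrm_bounded cA.
exists (r / c); first by rewrite /= divr_gt0.
move=> S /= Sr x Ax; rewrite norm_lt_nrm nrmB.
change (nrm ((S - Y) x) < r).
rewrite (le_lt_trans (nrm_bop _ _))//.
have [->|xn0] := eqVneq (nrm x) 0; first by rewrite mulr0.
have x0 : 0 < nrm x by rewrite lt_neqAle eq_sym xn0 nrm_ge0.
rewrite (le_lt_trans (ler_wpM2r (nrm_ge0 _) Sr))// mulrAC ltr_pdivrMr//.
by rewrite ltr_pM2l// Ac.
Qed.

(** The last hypothesis says that [V] is open for uniform convergence on compact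
    sets; this form also covers the coarser topology of pointwise convergence. *)
Lemma COT_finite_ball (V : set (bounded_op lp)) (T : bounded_op lp) : V T ->
  (forall S, V S -> nbhs (S : operators_COT lp) V) ->
  exists n Y, exists2 e, 0 < e & forall S, opnorm (S - fin_mx p1 n Y) <= e -> V S.
Proof.
move=> VT Vo; have [n /Vo nV] := COT_finite_section (Vo _ VT).
by exists n, (fun i j => T (lp_basis k p1 j) i); exact: COT_opnorm_ball.
Qed.

Lemma sandwich_SOT_continuous (A T : bounded_op lp) :
  continuous (sandwich A T : operators_SOT lp -> operators_SOT lp).
Proof.
move=> S; apply: (@SOT_cvgP K lp ((sandwich A T : operators_SOT lp ->
  operators_SOT lp) @ nbhs (S : operators_SOT lp)) (sandwich A T S)
  (@fmap_filter _ _ _ _ (@nbhs_filter (operators_SOT lp) S))).2 => x.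
have /SOT_cvgP /(_ (T x)) h := @cvg_id _ (nbhs (S : operators_SOT lp)).
apply: (@cvg_comp _ _ _ (fun f : operators_SOT lp => bop_fun f (T x)) A _ _ _ h).
exact: (@bop_continuous _ _ A (S (T x))).
Qed.

Lemma sandwich_COT_continuous (A T : bounded_op lp) :
  continuous (sandwich A T : operators_COT lp -> operators_COT lp).
Proof.
move=> S; apply: (@COT_cvgP K lp ((sandwich A T : operators_COT lp ->
  operators_COT lp) @ nbhs (S : operators_COT lp)) (sandwich A T S)
  (@fmap_filter _ _ _ _ (@nbhs_filter (operators_COT lp) S))).2 => C cC e /gt0_of_real[r r0 ->].
have cTC : compact (T @` C).
  by apply: continuous_compact cC; apply: continuous_subspaceT; exact: bop_continuous.
have A0 : 0 < opnorm A + 1 by rewrite ltr_wpDl// opnorm_ge0.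
have rA : 0 < of_real (r / (opnorm A + 1)) :> K.
  by rewrite -(@of_real0 R k) ltr_of_real divr_gt0.
have := COT_nbhs S cTC rA; apply: filterS => f h x Cx /=.
rewrite norm_lt_nrm -linearB/= (le_lt_trans (nrm_bop _ _))//.
have := h (T x) (ex_intro2 _ _ x Cx erefl).
rewrite norm_lt_nrm ltr_pdivlMr// mulrC; apply: le_lt_trans.
by rewrite ler_wpM2r ?nrm_ge0// lerDl.
Qed.

Lemma sandwich_cop_lin_cont (A T : bounded_op lp) :
  linear (sandwich_cop A T) /\ continuous (sandwich_cop A T).
Proof.
apply/asboolP; apply: (@lin_cont_bound _ _ _ (of_real (opnorm A * opnorm T))).
- by apply: of_real_real; rewrite mulr_ge0 ?opnorm_ge0.
- by move=> a f g; apply: val_inj; exact: sandwich_linear.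
- move=> f.
  change (of_real (opnorm (sandwich A T f)) <=
    of_real (opnorm A * opnorm T) * of_real (opnorm f) :> K).
  rewrite -of_realM ler_of_real (le_trans (opnorm_comp _ _))// -mulrA.
  rewrite ler_wpM2l ?opnorm_ge0// (le_trans (opnorm_comp _ _))// mulrC//.
Qed.

Lemma iter_sandwich_cop (A T : bounded_op lp) n (D : compact_op lp) :
  iter n (sandwich_cop A T) D = iter n (sandwich A T) D :> bounded_op lp.
Proof. by elim: n => //= n ->. Qed.

End OperatorTopologies.

Lemma nbhs_cop_opnorm_ball (R : realType) (k : scalar_kind) (p : R) (p1 : 1 <= p)
    (T : compact_op (lp k p1)) (V : set (compact_op (lp k p1))) : nbhs T V ->
  exists2 e : R, 0 < e & forall S : compact_op (lp k p1), opnorm (cop_bop S - cop_bop T) <= e -> V S.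
Proof.
move=> /nbhs_ballP[e' /= /gt0_of_real[e e0 ->] eV].
exists (e / 2); first by rewrite divr_gt0.
move=> S Se; apply: eV; rewrite -ball_normE /=.
rewrite distrC; change (of_real (opnorm (cop_bop S - cop_bop T)) < of_real e :> scalars R k).
by rewrite ltr_of_real (le_lt_trans Se)// ltr_pdivrMr// ltr_pMr// ltr1n.
Qed.

Unset Implicit Arguments.

Theorem proposition3p10 (R : realType) (k : scalar_kind) (q : nat)
    (w mu : nat -> scalars R k) (q_gt0 : (0 < q)%N)
    (w_bounded : bounded_weights w) (mu_bounded : bounded_weights mu)
    (w_mu_lim : forall (i j : nat) (M : R),
      \forall n \near \oo, forall r : nat,
        M <= modulus
          ((\prod_(1 <= l < ((n + r) ^ q - r ^ q + i).+1) w l) *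
           (\prod_(1 <= l < ((n + r) ^ q - r ^ q + j).+1) mu l))) :
  [/\ q_frequently_hypercyclic R (operators_SOT (lp k (lexx (1 : R)))) q
        (sandwich (backward_shift (lexx 1) w_bounded)
                  (forward_shift (lexx 1) mu_bounded)),
      forall (p : R) (p1 : 1 < p),
        q_frequently_hypercyclic R (compact_op (lp k (ltW p1))) q
          (sandwich_cop (backward_shift (ltW p1) w_bounded)
                        (forward_shift (ltW p1) mu_bounded)) &
      forall (p : R) (p1 : 1 < p),
        q_frequently_hypercyclic R (operators_COT (lp k (ltW p1))) q
          (sandwich (backward_shift (ltW p1) w_bounded)
                    (forward_shift (ltW p1) mu_bounded))].
Proof.
have orbit p (p1 : 1 <= p) := dense_orbit p1 w_bounded mu_bounded q_gt0 w_mu_lim.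
split=> [|p p1|p p1].
- have [D DP] := orbit 1 (lexx 1).
  apply: (@q_frequently_hypercyclic_of_orbit _ _ _ _ _ (D : operators_SOT _) q_gt0).
  + exact: sandwich_linear.
  + exact: sandwich_SOT_continuous.
  + move=> V oV [T VT].
    have [|n [Y [e e0 YV]]] := @COT_finite_ball _ _ _ _ V T VT.
      by move=> S VS; apply: nbhs_SOT_COT; exact: open_nbhs_nbhs.
    have [C [u ui uP]] := DP n Y e e0; exists C, u => // s.
    by have [u0 us /YV] := uP s.
- have [D DP] := orbit p (ltW p1).
  apply: (@q_frequently_hypercyclic_of_orbit _ _ _ _ _ D q_gt0).
  + exact: (sandwich_cop_lin_cont _ _).1.
  + exact: (sandwich_cop_lin_cont _ _).2.
  + move=> V oV [T VT].
    have nV : nbhs T V by exact: open_nbhs_nbhs.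
    have [e e0 eV] := nbhs_cop_opnorm_ball nV.
    have e2 : 0 < e / 2 by rewrite divr_gt0.
    have [n /(_ n (leqnn _)) Tn] := finite_section_cvg p1 (cop_bopP T) e2.
    have [C [u ui uP]] := DP n (fun i j => T (lp_basis k (ltW p1) j) i) _ e2.
    exists C, u => // s; have [u0 us uT] := uP s; split => //.
    apply: eV; rewrite iter_sandwich_cop -[_ - _](subrKA (finite_section T n)) (splitr e).
    apply: le_trans (opnormD _ _) _; apply: lerD; first exact: uT.
    rewrite opnormB; exact: Tn.
- have [D DP] := orbit p (ltW p1).
  apply: (@q_frequently_hypercyclic_of_orbit _ _ _ _ _ (D : operators_COT _) q_gt0).
  + exact: sandwich_linear.
  + exact: sandwich_COT_continuous.
  + move=> V oV [T VT].
    have [|n [Y [e e0 YV]]] := @COT_finite_ball _ _ _ _ V T VT.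
      by move=> S VS; exact: open_nbhs_nbhs.
    have [C [u ui uP]] := DP n Y e e0; exists C, u => // s.
    by have [u0 us /YV] := uP s.
Qed.
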